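(* Let $K$ be an infinite field of characteristic different from $2$ and $3$; all algebras are over $K$. All finitely generated Bernstein algebras which are algebraic of bounded degree $\le 2$ (in particular, all finitely generated Bernstein algebras that are train algebras of rank at most $3$) are finite-dimensional. In contrast, there exists an infinite-dimensional finitely generated Bernstein algebra that is a train algebra of rank $4$. Moreover, for all $d\ge 3$ and $n\ge 2$ there exists an infinite-dimensional finitely generated Bernstein algebra with $n$ generators which is algebraic of bounded degree $d$.
   Context: Algebras are not assumed associative, unital or finite-dimensional. A Bernstein algebra over $K$ is a commutative $K$-algebra $A$ with a nonzero algebra homomorphism $\omega:A\to K$ satisfying $(x^2)^2=\omega(x)^2x^2$ for all $x$. An algebra is finitely generated (with $n$ generators) if it is generated as an algebra by a finite subset (of $n$ elements). An element $a$ is algebraic of degree $\deg(a)=\dim\mathrm{alg}(a)$ if the subalgebra $\mathrm{alg}(a)$ generated by $a$ is finite-dimensional. $A$ is algebraic of bounded degree if all elements are algebraic with degrees bounded collectively; its bounded degree is $\min\{n\ge 1: \deg(a)\le n\ \forall a\in A\}$. Principal powers: $x^1=x$, $x^{k+1}=x^kx$. A commutative algebra with weight function $\omega$ is a train algebra of rank $r$ if there are $\gamma_1,\dots,\gamma_{r-1}\in K$ with $x^r+\gamma_1\omega(x)x^{r-1}+\cdots+\gamma_{r-1}\omega(x)^{r-1}x=0$ for all $x\in A$, where $r\ge2$ is the smallest integer for which such an equation holds. *)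

(* Defs.v *)
From HB Require Import structures.
From mathcomp Require Import all_boot all_algebra.
From mathcomp Require Import boolp classical_sets functions cardinality.

Set Implicit Arguments.
Unset Strict Implicit.
Unset Printing Implicit Defensive.

Import GRing.Theory.
Local Open Scope classical_set_scope.
Local Open Scope ring_scope.

(* Vector spaces over K may be infinite-dimensional, so {vspace _} does not    *)
(* apply; subspaces are sets, and dimension is the relation has_dim.           *)
Section Dimension.
Context {K : fieldType} {A : lmodType K}.

Definition lincomb n (b : 'I_n -> A) (c : 'rV[K]_n) : A :=
  \sum_i c 0 i *: b i.

Definition lin_indep n (b : 'I_n -> A) : Prop :=
  forall c : 'rV[K]_n, lincomb b c = 0 -> c = 0.

Definition has_dim (V : set A) (n : nat) : Prop :=
  exists b : 'I_n -> A, lin_indep b /\ range (lincomb b) = V.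

End Dimension.

Definition finite_dim (K : fieldType) (A : lmodType K) : Prop :=
  exists n, has_dim [set: A] n.

(* A not necessarily associative or unital K-algebra is a K-vector space A     *)
(* with a bilinear product mul.                                                *)
Section Algebra.
Context {K : fieldType} {A : lmodType K}.
Variable mul : {bilinear A -> A -> A}.

Definition is_subalgebra (B : set A) : Prop :=
  [/\ B 0,
      forall (k : K) x y, B x -> B y -> B (k *: x + y)
    & forall x y, B x -> B y -> B (mul x y)].

Definition subalg_gen (S : set A) : set A := smallest is_subalgebra S.

Definition generated_by (n : nat) : Prop :=
  exists s : seq A,
    [/\ uniq s, size s = n & subalg_gen [set x | x \in s] = [set: A]].

Definition finitely_generated : Prop := exists n, generated_by n.

Definition algebraic_of_degree (a : A) (m : nat) : Prop :=
  has_dim (subalg_gen [set a]) m.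

Definition degrees_le (n : nat) : Prop :=
  forall a : A, exists2 m, algebraic_of_degree a m & (m <= n)%N.

Definition algebraic_of_bounded_degree (d : nat) : Prop :=
  [/\ (1 <= d)%N, degrees_le d
    & forall n, (1 <= n)%N -> degrees_le n -> (d <= n)%N].

Definition weight (w : {scalar A}) : Prop :=
  (forall x y, w (mul x y) = w x * w y) /\ (exists x, w x != 0).

Definition commutative_weighted (w : {scalar A}) : Prop :=
  commutative mul /\ weight w.

Definition bernstein (w : {scalar A}) : Prop :=
  commutative_weighted w /\
  (forall x, mul (mul x x) (mul x x) = (w x ^+ 2) *: mul x x).

(* Principal powers start at 1; the value at 0 is x by convention and is       *)
(* never used.                                                                 *)
Definition ppow (x : A) (k : nat) : A := iter k.-1 (fun y => mul y x) x.

Definition train_equation (w : {scalar A}) (r : nat) : Prop :=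
  exists gamma : nat -> K, forall x : A,
    ppow x r + \sum_(1 <= i < r) (gamma i * w x ^+ i) *: ppow x (r - i)%N = 0.

Definition train_algebra (w : {scalar A}) (r : nat) : Prop :=
  commutative_weighted w /\
  [/\ (2 <= r)%N, train_equation w r
    & forall s, (2 <= s)%N -> train_equation w s -> (r <= s)%N].

End Algebra.

(* Main.v *)
(**
Finite dimensionality. If every element has degree at most 2, then x, x^2, x^3
are dependent, and the Peirce decomposition with respect to the idempotent x^2
forces x^3 = x^2 whenever w x = 1. Linearizing this around an idempotent e, with
N = ker w = U + V its Peirce decomposition (e = 1/2 on U, e = 0 on V), gives
V^2 = 0, U^2 <= V, UV <= U, and x(yz) + y(xz) + z(xy) = 0 on N. Hence the
operators of V on U square to zero and anticommute, so that finitely many of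
them applied to finitely many vectors of U span a finite-dimensional space.
By induction on the number of elements of U one then shows that any finite set
of elements of U and V lies in a finite-dimensional subalgebra of N: the
subalgebra N1 generated by one u in U and a finite-dimensional W <= V is
P + W + u P with P the W-closure of u; the N1-module generated by the other
elements of U is C + u C with C their closure under the V-part of N1; and the
subalgebra generated by C + u C is stable under N1, because the identity makes
each operator of N1 act on products like an anti-derivation.

Infinite-dimensional examples. If U^2 = 0, the Bernstein identity holds for any
products V x U -> U and V x V -> U. Take V = K v + K w and let a v + b w act by
the nilpotent pencil [[0,a,0],[b,0,a],[0,-b,0]], made infinite-dimensional by a
polynomial variable; the products on V are chosen so that z z^2 = 0 for all z
in V, up to a nilpotent tail of length d - 3 which adjusts the degree.
*)
Require Import Defs.
From HB Require Import structures.
From mathcomp Require Import all_boot all_algebra.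
From mathcomp Require Import boolp classical_sets functions cardinality.
From mathcomp Require Import ring.

Set Implicit Arguments.
Unset Strict Implicit.
Unset Printing Implicit Defensive.

Import GRing.Theory.
Local Open Scope classical_set_scope.
Local Open Scope ring_scope.

(** * Linear identities and finite-dimensional subspaces *)

(* Reified linear combinations, to prove identities in a vector space over K by
   comparing the coefficients of the atoms with [ring] or [field]. *)
Inductive mexp (K : Type) : Type :=
  | MVar of nat
  | MZero
  | MAdd of mexp K & mexp K
  | MOpp of mexp K
  | MScale of K & mexp K.

Section ModuleNormalization.
Context {K : fieldType} {A : lmodType K}.

Fixpoint meval (s : seq A) (t : mexp K) : A :=
  match t with
  | MVar i => s`_i
  | MZero => 0
  | MAdd t1 t2 => meval s t1 + meval s t2
  | MOpp t1 => - meval s t1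
  | MScale c t1 => c *: meval s t1
  end.

Fixpoint mcoef (i : nat) (t : mexp K) : K :=
  match t with
  | MVar j => if i == j then 1 else 0
  | MZero => 0
  | MAdd t1 t2 => mcoef i t1 + mcoef i t2
  | MOpp t1 => - mcoef i t1
  | MScale c t1 => c * mcoef i t1
  end.

Lemma meval_mcoef (s : seq A) t :
  meval s t = \sum_(i < size s) mcoef i t *: s`_i.
Proof.
elim: t => [j||t1 IH1 t2 IH2|t1 IH|c t1 IH] /=; rewrite ?IH1 ?IH2 ?IH.
- case: (ltnP j (size s)) => [lt_js|le_sj].
    rewrite (bigD1 (Ordinal lt_js)) //= eqxx scale1r big1 ?addr0 // => i ne_ij.
    by rewrite (negbTE (_ : i != j :> nat)) ?scale0r.
  rewrite nth_default // big1 // => i _.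
  by rewrite ltn_eqF ?scale0r // (leq_trans (ltn_ord i)).
- by rewrite big1 // => i _; rewrite scale0r.
- by rewrite -big_split /=; apply: eq_bigr => i _; rewrite scalerDl.
- by rewrite -sumrN; apply: eq_bigr => i _; rewrite scaleNr.
- by rewrite scaler_sumr; apply: eq_bigr => i _; rewrite scalerA.
Qed.

(** A conjunction by recursion, so that simplification and [split] leave one scalar equation per
    atom. *)
Fixpoint mcoef_eq (n : nat) (t1 t2 : mexp K) : Prop :=
  if n is n'.+1 then mcoef n' t1 = mcoef n' t2 /\ mcoef_eq n' t1 t2 else True.

Lemma meval_eq (s : seq A) t1 t2 :
  mcoef_eq (size s) t1 t2 -> meval s t1 = meval s t2.
Proof.
move=> H; rewrite !meval_mcoef; apply: eq_bigr => -[i /= lt_is] _; congr (_ *: _).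
elim: (size s) H lt_is => //= n IHn [Hn H]; rewrite ltnS leq_eqVlt.
by case/orP => [/eqP->|/IHn->].
Qed.

End ModuleNormalization.

Ltac mod_index x s :=
  match s with
  | x :: _ => constr:(Some 0%N)
  | _ :: ?s' => match mod_index x s' with
                | Some ?i => constr:(Some i.+1) | None => constr:(@None nat) end
  | _ => constr:(@None nat)
  end.
Ltac mod_atoms t s :=
  match t with
  | 0 => s
  | (?t1 + ?t2)%R => let s1 := mod_atoms t1 s in mod_atoms t2 s1
  | (- ?t1)%R => mod_atoms t1 s
  | (_ *: ?t1)%R => mod_atoms t1 s
  | _ => match mod_index t s with
         | Some _ => s | None => constr:(t :: s) end
  end.
Ltac mod_reify K t s :=
  match t with
  | 0 => constr:(@MZero K)
  | (?t1 + ?t2)%R => let e1 := mod_reify K t1 s in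
                 let e2 := mod_reify K t2 s in constr:(MAdd e1 e2)
  | (- ?t1)%R => let e1 := mod_reify K t1 s in constr:(MOpp e1)
  | (?c *: ?t1)%R => let e1 := mod_reify K t1 s in constr:(MScale (c : K) e1)
  | _ => match mod_index t s with Some ?i => constr:(@MVar K i) end
  end.
(** The scalar field is found among the hypotheses. Nonvanishing conditions raised by [field], such
    as [2%:R != 0], may be left to the caller. *)
Ltac module_eq :=
  match goal with |- @eq ?T ?t1 ?t2 =>
    let s0 := mod_atoms t1 (@nil T) in let s := mod_atoms t2 s0 in
    match goal with K : fieldType |- _ =>
    let e1 := mod_reify (GRing.Field.sort K) t1 s in
    let e2 := mod_reify (GRing.Field.sort K) t2 s in
    refine (@meval_eq K _ s e1 e2 _); rewrite /=; repeat split; try (ring || field) end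
  end.

(** * Subspaces, spans and finite-dimensional sets *)

Section Span.
Context {K : fieldType} {A : lmodType K}.
Implicit Types (S T H : set A) (s : seq A).

Definition subspace H : Prop :=
  H 0 /\ forall (k : K) x y, H x -> H y -> H (k *: x + y).

Definition lspan S : set A := smallest subspace S.

(* The spanning vectors need not belong to S, so that subsets of fd sets are trivially fd. *)
Definition fd S : Prop := exists s, S `<=` lspan [set` s].

Lemma subspaceZ H k x : subspace H -> H x -> H (k *: x).
Proof. by case=> H0 HD Hx; rewrite -[_ *: _]addr0; apply: HD. Qed.

Lemma subspaceD H x y : subspace H -> H x -> H y -> H (x + y).
Proof. by case=> _ HD Hx Hy; rewrite -[x]scale1r; apply: HD. Qed.

Lemma subspaceN H x : subspace H -> H x -> H (- x).
Proof. by move=> sH Hx; rewrite -scaleN1r; apply: subspaceZ. Qed.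

Lemma subspaceB H x y : subspace H -> H x -> H y -> H (x - y).
Proof. by move=> sH Hx Hy; apply: subspaceD => //; apply: subspaceN. Qed.

Lemma subspace_sum H n (F : 'I_n -> A) :
  subspace H -> (forall i, H (F i)) -> H (\sum_i F i).
Proof.
by move=> sH HF; elim/big_ind: _ => //; [case: sH | move=> *; apply: subspaceD].
Qed.

Lemma subspace_smallest (C : set A -> Prop) S :
  (forall H, C H -> subspace H) -> subspace (smallest C S).
Proof.
move=> sC; split=> [H [CH _]|k x y Sx Sy H CSH]; first by case: (sC H CH).
by case: (sC H CSH.1) => _; apply; [apply: Sx | apply: Sy].
Qed.

Lemma subspace_lspan S : subspace (lspan S).
Proof. exact: subspace_smallest. Qed.

Lemma lspan_sub S H : subspace H -> S `<=` H -> lspan S `<=` H.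
Proof. exact: smallest_sub. Qed.

Lemma sub_lspan S : S `<=` lspan S.
Proof. exact: sub_gen_smallest. Qed.

Lemma subspaceI H1 H2 : subspace H1 -> subspace H2 -> subspace (H1 `&` H2).
Proof.
by move=> [H10 H1D] [H20 H2D]; split=> // k x y [? ?] [? ?]; split; auto.
Qed.

Lemma fd_subset S T : S `<=` T -> fd T -> fd S.
Proof. by move=> sST [s sTs]; exists s => x /sST /sTs. Qed.

Lemma fd_seq s : fd [set` s].
Proof. by exists s; apply: sub_lspan. Qed.

Lemma fd_lspan S : fd S -> fd (lspan S).
Proof. by case=> s sSs; exists s; apply: lspan_sub => //; apply: subspace_lspan. Qed.

Definition sumset S T : set A := [set x | exists2 a, S a & exists2 b, T b & x = a + b].

Lemma subspace_sumset S T : subspace S -> subspace T -> subspace (sumset S T).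
Proof.
move=> [S0 SD] [T0 TD]; split; first by exists 0 => //; exists 0; rewrite ?addr0.
move=> k _ _ [a Sa [b Tb ->]] [a' Sa' [b' Tb' ->]].
exists (k *: a + a'); first exact: SD.
by exists (k *: b + b'); [exact: TD | rewrite scalerDr addrACA].
Qed.

Lemma sumsetl S T : subspace T -> S `<=` sumset S T.
Proof. by case=> T0 _ x Sx; exists x => //; exists 0; rewrite ?addr0. Qed.

Lemma sumsetr S T : subspace S -> T `<=` sumset S T.
Proof. by case=> S0 _ x Tx; exists 0 => //; exists x; rewrite ?add0r. Qed.

Lemma sumset_sub S T H :
  subspace H -> S `<=` H -> T `<=` H -> sumset S T `<=` H.
Proof. by move=> sH SH TH _ [a /SH Ha [b /TH Hb ->]]; apply: subspaceD. Qed.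

Lemma fd_sumset S T : fd S -> fd T -> fd (sumset S T).
Proof.
move=> [s sS] [t sT]; exists (s ++ t); have sp := subspace_lspan [set` s ++ t].
apply: sumset_sub => // x.
  move=> /sS; apply: lspan_sub => // y ys; apply: sub_lspan => /=.
  by rewrite mem_cat (ys : y \in s).
move=> /sT; apply: lspan_sub => // y ys; apply: sub_lspan => /=.
by rewrite mem_cat (ys : y \in t) orbT.
Qed.

Lemma subspace_preimage (f : {linear A -> A}) H : subspace H -> subspace (f @^-1` H).
Proof.
case=> H0 HD; split; first by rewrite /preimage /= linear0.
by move=> k x y Hx Hy; rewrite /preimage /= linearP; apply: HD.
Qed.

Lemma subspace_image (f : {linear A -> A}) H : subspace H -> subspace (f @` H).
Proof.
case=> H0 HD; split; first by exists 0; rewrite ?linear0.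
by move=> k _ _ [x Hx <-] [y Hy <-]; exists (k *: x + y); [apply: HD | rewrite linearP].
Qed.

Lemma fd_image (f : {linear A -> A}) S : fd S -> fd (f @` S).
Proof.
case=> s sS; exists (map f s) => _ [x /sS Sx <-].
have sp := subspace_lspan [set` map f s].
suff : (f @^-1` lspan [set` map f s]) x by [].
apply: lspan_sub Sx; first exact: subspace_preimage.
by move=> y ys; apply: sub_lspan => /=; apply: map_f.
Qed.

Lemma lincomb_subspace H n (b : 'I_n -> A) c :
  subspace H -> (forall i, H (b i)) -> H (lincomb b c).
Proof. by move=> sH Hb; apply: subspace_sum => // i; apply: subspaceZ. Qed.

Lemma lincombP n (b : 'I_n -> A) k c d :
  lincomb b (k *: c + d) = k *: lincomb b c + lincomb b d.
Proof.
rewrite /lincomb scaler_sumr -big_split; apply: eq_bigr => i _ /=.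
by rewrite !mxE scalerDl scalerA.
Qed.

Lemma subspace_lincomb n (b : 'I_n -> A) : subspace (range (lincomb b)).
Proof.
split; first by exists 0 => //; rewrite /lincomb big1 // => i _; rewrite mxE scale0r.
by move=> k _ _ [c _ <-] [d _ <-]; exists (k *: c + d); rewrite ?lincombP.
Qed.

Lemma range_lincomb n (b : 'I_n -> A) i : range (lincomb b) (b i).
Proof.
exists (delta_mx 0 i) => //; rewrite /lincomb (bigD1 i) //= mxE !eqxx scale1r.
by rewrite big1 ?addr0 // => j ne_ji; rewrite mxE (negbTE ne_ji) andbF scale0r.
Qed.

(** Write [b] through [g] with an m by n matrix. If n < m, its left kernel is nonzero and yields a
    dependency among the [b i]. *)
Lemma indep_leq m n (b : 'I_m -> A) (g : 'I_n -> A) :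
  lin_indep b -> (forall i, range (lincomb g) (b i)) -> (m <= n)%N.
Proof.
move=> indb sbg.
have [M HM] : exists M : 'M[K]_(m, n), forall i, b i = lincomb g (row i M).
  have [f Hf] := choice (fun i => let: ex_intro2 c _ H := sbg i in
                                  ex_intro (fun c => lincomb g c = b i) c H).
  by exists (\matrix_i f i) => i; rewrite rowK Hf.
have combM c : lincomb b c = lincomb g (c *m M).
  rewrite /lincomb; under eq_bigr => i _ do rewrite HM /lincomb scaler_sumr.
  rewrite exchange_big; apply: eq_bigr => j _ /=.
  by rewrite !mxE scaler_suml; apply: eq_bigr => i _; rewrite scalerA mxE.
rewrite leqNgt; apply/negP => lt_nm.
have : kermx M != 0.
  by rewrite -mxrank_eq0 mxrank_ker subn_eq0 -ltnNge (leq_ltn_trans (rank_leq_col M)).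
case/eqP; apply/row_matrixP => i; rewrite row0; apply: indb.
rewrite combM -row_mul mulmx_ker row0 /lincomb big1 // => j _.
by rewrite mxE scale0r.
Qed.

(** By [indep_leq] the independent families in H have at most n members, and one of maximal length
    spans H. *)
Lemma subspace_has_dim H n (g : 'I_n -> A) :
  subspace H -> H `<=` range (lincomb g) -> exists2 m, has_dim H m & (m <= n)%N.
Proof.
move=> sH sHg.
pose P m := `[< exists b : 'I_m -> A, lin_indep b /\ forall i, H (b i) >].
have P0 : exists m, P m.
  exists 0%N; apply/asboolP; exists (fun=> 0); split; last by case.
  by move=> c _; apply/rowP => -[].
have Pn m : P m -> (m <= n)%N.
  by move=> /asboolP[b [indb Hb]]; apply: indep_leq indb _ => i; apply: sHg.
case: (ex_maxnP P0 Pn) => m /asboolP[b [indb Hb]] maxm.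
have sbH : range (lincomb b) `<=` H.
  by move=> _ [c _ <-]; apply: lincomb_subspace.
have sb := subspace_lincomb b.
exists m; last by apply: Pn; apply/asboolP; exists b.
exists b; split=> //; apply/seteqP; split=> // y Hy.
apply: contrapT => nby.
suff /maxm : P m.+1 by rewrite ltnn.
(* A vector y outside the span, put in front of [b], would give a longer independent family. *)
pose b' (i : 'I_m.+1) := if unlift ord0 i is Some j then b j else y.
apply/asboolP; exists b'; split; last first.
  by move=> i; rewrite /b'; case: unliftP.
move=> c; rewrite /lincomb big_ord_recl /b' unlift_none.
pose c' : 'rV_m := \row_j c 0 (lift ord0 j).
rewrite (_ : \sum_(i < m) _ = lincomb b c'); last first.
  by apply: eq_bigr => i _; rewrite liftK mxE.
move=> eq0; have c0 : c 0 ord0 = 0.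
  apply: contrapT => /eqP nz; apply: nby.
  move/eqP: eq0; rewrite addr_eq0 => /eqP yE.
  rewrite -(scalerK nz y) yE scalerN -scaleNr.
  by apply: subspaceZ => //; exists c'.
move: eq0; rewrite c0 scale0r add0r => /indb c'0.
apply/rowP => i; rewrite mxE; case: (unliftP ord0 i) => [j|] -> //.
by have := congr1 (fun M : 'rV_m => M 0 j) c'0; rewrite !mxE.
Qed.

Lemma lspan_seq s : lspan [set` s] `<=` range (lincomb (fun i : 'I_(size s) => s`_i)).
Proof.
apply: lspan_sub; first exact: subspace_lincomb.
move=> y /= /(nthP 0)[i lt_is <-].
exact: (range_lincomb (fun i : 'I_(size s) => s`_i) (Ordinal lt_is)).
Qed.

Lemma fd_lincomb S : fd S -> exists n (g : 'I_n -> A), S `<=` range (lincomb g).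
Proof.
by case=> s sS; exists (size s), (fun i => s`_i) => x /sS; apply: lspan_seq.
Qed.

Lemma fd_has_dim H : subspace H -> fd H -> exists n, has_dim H n.
Proof.
move=> sH /fd_lincomb[n [g /(subspace_has_dim sH)[m ? _]]]; by exists m.
Qed.

(** The list given by [fd] may leave H; going through a basis provides spanning vectors inside H. *)
Lemma fd_basis H : subspace H -> fd H ->
  exists2 s : seq A, (forall x, x \in s -> H x) & H `<=` lspan [set` s].
Proof.
move=> sH /(fd_has_dim sH)[n [b [_ <-]]]; exists (codom b).
  by move=> _ /codomP[i ->]; apply: range_lincomb.
move=> _ [c _ <-]; apply: lincomb_subspace; first exact: subspace_lspan.
by move=> i; apply: sub_lspan; apply: codom_f.
Qed.

End Span.

(** * Nil algebras N = U + V with V^2 = 0 *)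

Section NilAlgebra.
Context {K : fieldType} {A : lmodType K}.
Variable mul : {bilinear A -> A -> A}.
Hypotheses (K2 : 2%:R != 0 :> K) (K3 : 3%:R != 0 :> K).
Hypothesis mulC : commutative mul.
Variables (N U V : set A).
Hypotheses (sU : subspace U) (sV : subspace V) (sN : subspace N).
Hypotheses (UN : U `<=` N) (VN : V `<=` N).
Hypothesis mulUU : forall a b, U a -> U b -> V (mul a b).
Hypothesis mulVU : forall v a, V v -> U a -> U (mul v a).
Hypothesis mulVV : forall v v', V v -> V v' -> mul v v' = 0.
(** The full linearization of x^3 = 0, up to the factor 2. *)
Hypothesis jacobi : forall x y z, N x -> N y -> N z ->
  mul x (mul y z) + mul y (mul x z) + mul z (mul x y) = 0.

Lemma add_eq0 (x y : A) : x + y = 0 -> x = - y.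
Proof. by move/eqP; rewrite addr_eq0 => /eqP. Qed.

(** The third term of the identity is the product of v with ab, which lies in V, so it vanishes. An
    operator of V thus moves from one factor to the other with a sign. *)
Lemma antiU a b v : U a -> U b -> V v -> mul (mul v a) b = - mul a (mul v b).
Proof.
move=> Ua Ub Vv; have := jacobi (UN Ua) (UN Ub) (VN Vv).
rewrite (mulVV Vv (mulUU Ua Ub)) addr0 (mulC b v) (mulC a v) (mulC b).
by rewrite addrC => /add_eq0.
Qed.

(** The term containing [mul v' v] vanishes, so operators of V anticommute on U. *)
Lemma antiV a v v' : U a -> V v -> V v' -> mul v' (mul v a) = - mul v (mul v' a).
Proof.
move=> Ua Vv Vv'; have := jacobi (VN Vv') (VN Vv) (UN Ua).
by rewrite (mulVV Vv' Vv) linear0 addr0 => /add_eq0.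
Qed.

Lemma double_eq0 (x : A) : x + x = 0 -> x = 0.
Proof. by rewrite -mulr2n -scaler_nat => /eqP; rewrite scaler_eq0 (negbTE K2) => /eqP. Qed.

Lemma mulVVU v a : V v -> U a -> mul v (mul v a) = 0.
Proof.
move=> Vv Ua; apply: double_eq0.
by rewrite {1}(antiV Ua Vv Vv) addNr.
Qed.

Lemma mulU_sq u c : U u -> U c -> mul u (mul u c) + mul u (mul u c) = - mul (mul u u) c.
Proof.
move=> Uu Uc; have := jacobi (UN Uu) (UN Uu) (UN Uc).
by rewrite (mulC c) => /add_eq0.
Qed.

(** The case c = u of [mulU_sq] reads 3 u^3 = 0. *)
Lemma mulU_cube u : U u -> mul (mul u u) u = 0.
Proof.
move=> Uu; have := mulU_sq Uu Uu; rewrite (mulC (mul u u)) => /eqP.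
rewrite -addr_eq0 -mulr2n -mulrSr -scaler_nat scaler_eq0 (negbTE K3).
by move/eqP.
Qed.

Definition stable (W X : set A) : Prop := forall w x, W w -> X x -> X (mul w x).

Definition stable_closure (W X : set A) : set A :=
  smallest (fun H => subspace H /\ stable W H) X.

Lemma subspace_stable_closure W X : subspace (stable_closure W X).
Proof. by apply: subspace_smallest => H []. Qed.

Lemma stable_stable_closure W X : stable W (stable_closure W X).
Proof. by move=> w x Ww Sx H CH; apply: CH.1.2 => //; apply: Sx. Qed.

Lemma sub_stable_closure W X : X `<=` stable_closure W X.
Proof. exact: sub_gen_smallest. Qed.

Lemma stable_closure_sub W X H :
  subspace H -> stable W H -> X `<=` H -> stable_closure W X `<=` H.
Proof. by move=> sH stH XH; apply: smallest_sub. Qed.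

Lemma stable_closure_subU W X : W `<=` V -> X `<=` U -> stable_closure W X `<=` U.
Proof. by move=> WV XU; apply: stable_closure_sub => // w x /WV; apply: mulVU. Qed.

Lemma subspace_stabilizer H : subspace H -> subspace [set w | forall x, H x -> H (mul w x)].
Proof.
move=> sH; split=> [x Hx /=|k y z Hy Hz x Hx /=]; first by rewrite linear0l; case: sH.
by rewrite linearPl; apply: sH.2; [apply: Hy | apply: Hz].
Qed.

(* The operators of V square to zero and anticommute on U, so each new one at most doubles the space. *)
Lemma fd_stable_closure_seq (s : seq A) X : (forall x, x \in s -> V x) ->
  X `<=` U -> fd X -> fd (stable_closure [set` s] X).
Proof.
move=> sV' XU fdX; elim: s sV' => [|w s IHs] sVs.
  apply: fd_subset (fd_lspan fdX); apply: stable_closure_sub => //.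
  - exact: subspace_lspan.
  - exact: sub_lspan.
have Vw : V w by apply: sVs; rewrite mem_head.
have Vs x : x \in s -> V x by move=> xs; apply: sVs; rewrite inE xs orbT.
set C := stable_closure [set` s] X in IHs.
have sC : subspace C by apply: subspace_stable_closure.
have CU : C `<=` U by apply: stable_closure_subU.
apply: fd_subset (fd_sumset (IHs Vs) (fd_image (mul w) (IHs Vs))).
have sCw := subspace_image (mul w) sC.
apply: stable_closure_sub; first exact: subspace_sumset.
(* On a + wb with a, b in C, the new w gives wa since w(wb) = 0, and v from [s] gives va + w(-vb) by
   anticommutation. *)
- move=> v _ /= vs [a Ca [_ [b Cb <-] ->]]; rewrite linearD /=.
  move: vs; rewrite inE => /predU1P[->|vs].
    rewrite (mulVVU Vw (CU _ Cb)) addr0.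
    by apply: sumsetr => //; exists a.
  exists (mul v a); first exact: stable_stable_closure.
  exists (mul w (- mul v b)); last by rewrite linearN (antiV (CU _ Cb) Vw) //; apply: Vs.
  by exists (- mul v b) => //; apply: (subspaceN sC); exact: stable_stable_closure.
- by move=> x Xx; apply: sumsetl => //; apply: sub_stable_closure.
Qed.

Lemma fd_stable_closure W X : subspace W -> W `<=` V -> fd W ->
  X `<=` U -> fd X -> fd (stable_closure W X).
Proof.
move=> sW WV fdW XU fdX; have [s sW' Ws] := fd_basis sW fdW.
have sVs x : x \in s -> V x by move=> /sW' /WV.
apply: fd_subset (fd_stable_closure_seq sVs XU fdX).
apply: stable_closure_sub; first exact: subspace_stable_closure.
- move=> w x /Ws ws; move: x; move: w ws; apply: lspan_sub.
    exact: subspace_stabilizer (subspace_stable_closure _ _).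
  by move=> w ws x; apply: stable_stable_closure.
- exact: sub_stable_closure.
Qed.

(** Unlike minimality alone, this induction also provides membership of [a] in the closure, hence in
    U where the sign rules apply. *)
Lemma stable_closure_ind W X H : subspace H ->
    (forall w a, W w -> stable_closure W X a -> H a -> H (mul w a)) ->
  X `<=` H -> stable_closure W X `<=` H.
Proof.
move=> sH stH XH; suff sub : stable_closure W X `<=` H `&` stable_closure W X.
  by move=> x /sub[].
have sC := subspace_stable_closure W X.
apply: stable_closure_sub; first exact: subspaceI.
  by move=> w x Ww [Hx Cx]; split; [apply: stH | apply: stable_stable_closure].
by move=> x Xx; split; [apply: XH | apply: sub_stable_closure].
Qed.

(** * Adjoining one element of U to a finite-dimensional subspace of V *)

Section AdjoinU.
Variables (W : set A) (u : A).
Hypotheses (sW : subspace W) (WV : W `<=` V) (fdW : fd W) (Uu : U u).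

(** P and Q are the U-part and the V-part of the subalgebra N1. *)
Let P := stable_closure W [set u].
Let Q := sumset W (mul u @` P).

Let sP : subspace P. Proof. exact: subspace_stable_closure. Qed.

Let PU : P `<=` U.
Proof. by apply: stable_closure_subU => // _ ->. Qed.

Let Pu : P u. Proof. exact: sub_stable_closure. Qed.

Let QV : Q `<=` V.
Proof. by apply: sumset_sub => // _ [a /PU Ua <-]; apply: mulUU. Qed.

Let sQ : subspace Q.
Proof. by apply: subspace_sumset => //; apply: (subspace_image (mul u)). Qed.

Let WQ : W `<=` Q.
Proof. by apply: sumsetl; apply: (subspace_image (mul u)). Qed.

Let mulPQ a : P a -> Q (mul u a).
Proof. by move=> Pa; apply: sumsetr => //; exists a. Qed.

Let fdP : fd P.
Proof.
apply: fd_stable_closure => //; first by move=> _ ->.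
by apply: fd_subset (fd_seq [:: u]) => x -> /=; rewrite mem_head.
Qed.

Let fdQ : fd Q. Proof. exact: fd_sumset fdW (fd_image (mul u) fdP). Qed.

Lemma subspace_mulr_in (H T : set A) :
  subspace H -> subspace [set a | forall c, T c -> H (mul a c)].
Proof.
move=> sH; split=> [c _|k a b Ha Hb c Tc] /=; first by rewrite linear0l; case: sH.
by rewrite linearPl; apply: sH.2; [apply: Ha | apply: Hb].
Qed.

(* Moving operators across the product, P * C is already u * C. *)
Lemma mul_closure1 C a c : subspace C -> stable W C -> C `<=` U ->
  P a -> C c -> (mul u @` C) (mul a c).
Proof.
move=> sC stC CU Pa; move: c; move: a Pa; apply: stable_closure_ind.
- by apply: subspace_mulr_in; apply: (subspace_image (mul u)).
- move=> w a Ww Pa IHa c Cc.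
  rewrite (antiU (PU Pa) (CU _ Cc) (WV Ww)) -linearN.
  by apply: IHa; apply: (subspaceN sC); apply: stC.
- by move=> _ -> c Cc; exists c.
Qed.

(** u^2 kills u by [mulU_cube], and as an element of V it anticommutes with the operators of W that
    build P from u. *)
Let mulUU_P c : P c -> mul (mul u u) c = 0.
Proof.
move: c; apply: (@stable_closure_ind _ _ [set c | mul (mul u u) c = 0]).
- by apply: (subspace_preimage (mul (mul u u)) (H := [set 0])); split=> // k _ _ -> -> /=; rewrite scaler0 addr0.
- move=> w a Ww Pa /= IHa; rewrite (antiV (PU Pa) (WV Ww)) ?IHa ?linear0 ?oppr0 //.
  exact: mulUU.
- by move=> _ -> /=; apply: mulU_cube.
Qed.

(** At a = u, twice the product is -(u^2)c, which is 0 by [mulUU_P]; the operators of W are passed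
    as before. Hence Q acts on P through W alone. *)
Let mulQP c a : P c -> P a -> mul (mul u c) a = 0.
Proof.
move=> Pc; have Vuc : V (mul u c) by apply: mulUU => //; apply: PU.
move: a; apply: (@stable_closure_ind _ _ [set a | mul (mul u c) a = 0]).
- by apply: (subspace_preimage (mul (mul u c)) (H := [set 0])); split=> // k _ _ -> -> /=; rewrite scaler0 addr0.
- move=> w a Ww Pa /= IHa.
  by rewrite (antiV (PU Pa) (WV Ww)) // IHa linear0 oppr0.
- move=> _ -> /=; apply: double_eq0; rewrite (mulC _ u).
  by rewrite mulU_sq ?mulUU_P ?oppr0 //; apply: PU.
Qed.

Let stQP : stable Q P.
Proof.
move=> _ a [w Ww [_ [c Pc <-] ->]] Pa; rewrite linearDl mulQP // addr0.
exact: stable_stable_closure.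
Qed.

(** For a = u, u(uc) = -(1/2) u^2 c with u^2 in Q. A factor w on a is moved out, since w and uc are
    both in V and anticommute. *)
Let mul_closure2 C a c : subspace C -> stable Q C -> C `<=` U ->
  P a -> C c -> C (mul a (mul u c)).
Proof.
move=> sC stC CU Pa; move: c; move: a Pa; apply: stable_closure_ind.
- split=> [c _|k a b Ha Hb c Cc] /=; first by rewrite linear0l; case: sC.
  by rewrite linearPl; apply: sC.2; [apply: Ha | apply: Hb].
- move=> w a Ww Pa /= IHa c Cc; have Vw := WV Ww.
  have Vuc : V (mul u c) by apply: mulUU => //; apply: CU.
  rewrite (mulC (mul w a)) (antiV (PU Pa) Vw Vuc) (mulC _ a).
  by apply: (subspaceN sC); apply: stC; [apply: WQ | apply: IHa].
- move=> _ -> c Cc; rewrite (_ : mul u _ = (- 2^-1) *: mul (mul u u) c).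
    by apply: (subspaceZ _ sC); apply: stC => //; apply: mulPQ.
  have /(congr1 (fun x => 2^-1 *: x)) := mulU_sq Uu (CU _ Cc).
  rewrite scalerN scaleNr => <-; rewrite -mulr2n -scaler_nat scalerA.
  by rewrite mulVf // scale1r.
Qed.

Let N1 := sumset P Q.

Let N1_sub : N1 `<=` N.
Proof. by apply: sumset_sub => // x; [move/PU/UN | move/QV/VN]. Qed.

Let mulN1 : is_subalgebra mul N1.
Proof.
have sN1 : subspace N1 by apply: subspace_sumset.
split; [by case: sN1 | by case: sN1 |].
move=> _ _ [a Pa [v Qv ->]] [b Pb [w Qw ->]].
rewrite linearDl !linearD /= (mulVV (QV Qv) (QV Qw)) addr0.
have stWP : stable W P by apply: stable_stable_closure.
apply: (subspaceD sN1); first apply: (subspaceD sN1).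
- by apply: sumsetr => //; apply: sumsetr => //; apply: mul_closure1.
- by rewrite mulC; apply: sumsetl => //; apply: stQP.
- by apply: sumsetl => //; apply: stQP.
Qed.

(** Induction step on the number of elements of U. The hypothesis quantifies over [W'] because it is
    used with the larger space Q + uC. The result is N1 + M, where M is generated by C + uC. *)
Lemma adjoin_fd (us : seq A) :
    (forall x, x \in us -> U x) ->
    (forall W', subspace W' -> W' `<=` V -> fd W' -> exists B,
      [/\ is_subalgebra mul B, B `<=` N, fd B, [set` us] `<=` B & W' `<=` B]) ->
  exists B, [/\ is_subalgebra mul B, B `<=` N, fd B, [set` u :: us] `<=` B & W `<=` B].
Proof.
move=> Uus IH; pose C := stable_closure Q [set` us].
have sC : subspace C by apply: subspace_stable_closure.
have CU : C `<=` U by apply: stable_closure_subU.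
have stQC : stable Q C by apply: stable_stable_closure.
have stWC : stable W C by move=> w c Ww; apply: stQC; apply: WQ.
have fdC : fd C by apply: fd_stable_closure => //; apply: fd_seq.
pose D := mul u @` C; have sD : subspace D by apply: (subspace_image (mul u)).
have DV : D `<=` V by move=> _ [c Cc <-]; apply: mulUU => //; apply: CU.
(* B serves only as a finite-dimensional bound: it contains Q, uC and [us], hence also C and M. *)
have [||B [aB BN fdB usB QDB]] := IH (sumset Q D) (subspace_sumset sQ sD).
- exact: sumset_sub.
- exact: fd_sumset fdQ (fd_image (mul u) fdC).
have sB : subspace B by case: aB.
have stB x y : B x -> B y -> B (mul x y) by case: aB => _ _; apply.
have QB : Q `<=` B by move=> x Qx; apply: QDB; apply: sumsetl.
have DB : D `<=` B by move=> x Dx; apply: QDB; apply: sumsetr.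
have CB : C `<=` B.
  by apply: stable_closure_sub => // v x /QB Bv Bx; apply: stB.
pose X := sumset C D; pose M := subalg_gen mul X.
have XB : X `<=` B by apply: sumset_sub.
have MB : M `<=` B by apply: smallest_sub.
have sM : subspace M by apply: subspace_smallest => H [].
have aM x y : M x -> M y -> M (mul x y).
  by move=> Mx My H CH; case: (CH.1) => _ _; apply; [apply: Mx | apply: My].
have XM : X `<=` M by apply: sub_gen_smallest.
(* For a in P and v in Q: ac lies in uC, a(uc') and vc lie in C, and v(uc') = 0. *)
have N1X b x : N1 b -> X x -> X (mul b x).
  move=> [a Pa [v Qv ->]] [c Cc [_ [c' Cc' <-] ->]].
  have Vuc' : V (mul u c') by apply: DV; exists c'.
  rewrite linearDl !linearD /= (mulVV (QV Qv) Vuc') addr0 -addrA addrC.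
  exists (mul a (mul u c') + mul v c); last by exists (mul a c); first exact: (mul_closure1 sC).
  by apply: (subspaceD sC); [apply: (mul_closure2 sC) | apply: stQC].
(* The identity gives b(yz) = -(y(bz) + z(by)), so stability passes to products; membership in M is
   carried along for that purpose. *)
have N1M b x : N1 b -> M x -> M (mul b x).
  move=> N1b; suff sub : M `<=` [set x | M x /\ M (mul b x)] by move=> /sub[].
  apply: smallest_sub => [|y Xy]; last by split; apply: XM => //; apply: N1X.
  split=> [|k y z [My Mby] [Mz Mbz]|y z [My Mby] [Mz Mbz]].
  - by rewrite /= linear0; split; apply: sM.1.
  - by rewrite /= linearP; split; apply: sM.2.
  - split; first exact: aM.
    have := jacobi (N1_sub N1b) (BN _ (MB _ My)) (BN _ (MB _ Mz)).
    rewrite -addrA => /add_eq0 ->; apply: (subspaceN sM).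
    by apply: (subspaceD sM); apply: aM.
have sN1 : subspace N1 by case: mulN1.
have aN1 x y : N1 x -> N1 y -> N1 (mul x y) by case: mulN1 => _ _; apply.
have sNM : subspace (sumset N1 M) by apply: subspace_sumset.
exists (sumset N1 M); split.
- split; [by case: sNM | by case: sNM |].
  move=> _ _ [a Na [x Mx ->]] [b Nb [y My ->]].
  rewrite linearDl !linearD /=; apply: (subspaceD sNM); apply: (subspaceD sNM).
  + by apply: sumsetl => //; apply: aN1.
  + by apply: sumsetr => //; apply: N1M.
  + by rewrite mulC; apply: sumsetr => //; apply: N1M.
  + by apply: sumsetr => //; apply: aM.
- by apply: sumset_sub => // x /MB /BN.
- by apply: fd_sumset (fd_sumset fdP fdQ) (fd_subset MB fdB).
- move=> x /=; rewrite inE => /predU1P[->|xs].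
    by apply: sumsetl => //; apply: sumsetl.
  apply: sumsetr => //; apply: XM; apply: sumsetl => //.
  exact: sub_stable_closure.
- by move=> x Wx; apply: sumsetl => //; apply: sumsetr => //; apply: WQ.
Qed.

End AdjoinU.

(** With no element of U left, W itself is a subalgebra because V^2 = 0. W varies in the induction
    since each step enlarges it. *)
Lemma fd_subalgebra (us : seq A) (W : set A) :
    (forall x, x \in us -> U x) -> subspace W -> W `<=` V -> fd W ->
  exists B, [/\ is_subalgebra mul B, B `<=` N, fd B, [set` us] `<=` B & W `<=` B].
Proof.
elim: us W => [|u us IHus] W Uus sW WV fdW.
  exists W; split=> //; last by move=> x /WV /VN.
  split; [by case: sW | by case: sW |].
  by move=> x y /WV Vx /WV Vy; rewrite mulVV //; case: sW.
have Uus' x : x \in us -> U x by move=> xs; apply: Uus; rewrite inE xs orbT.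
apply: adjoin_fd => //; first by apply: Uus; rewrite mem_head.
by move=> W' sW' W'V fdW'; apply: IHus.
Qed.

End NilAlgebra.

(** * Bernstein algebras of degree at most 2 *)

Lemma scale_eq0 (K : fieldType) (A : lmodType K) (c : K) (x : A) :
  c != 0 -> c *: x = 0 -> x = 0.
Proof. by move=> nz_c /eqP; rewrite scaler_eq0 (negbTE nz_c) => /eqP. Qed.

Section SmallDegree.
Context {K : fieldType} {A : lmodType K}.
Hypotheses (K2 : 2%:R != 0 :> K) (K3 : 3%:R != 0 :> K).

(** This separates the homogeneous components of an identity evaluated along a line [e + t *: y]. *)
Lemma quartic_coef (a0 a1 a2 a3 a4 : A) :
    (forall t : K, a0 + t *: a1 + t ^+ 2 *: a2 + t ^+ 3 *: a3 + t ^+ 4 *: a4 = 0) ->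
  [/\ a1 = 0, a2 = 0 & a3 = 0].
Proof.
(* Interpolation at 0, 1, -1, 2, -2. *)
move=> H; pose p t := a0 + t *: a1 + t ^+ 2 *: a2 + t ^+ 3 *: a3 + t ^+ 4 *: a4.
have p0 t : p t = 0 by apply: H.
have n12 : 12%:R != 0 :> K by rewrite (natrM _ 3 4) (natrM _ 2 2) !mulf_neq0.
have n24 : 24%:R != 0 :> K by rewrite (natrM _ 2 12) mulf_neq0.
split; [apply: (scale_eq0 n12) | apply: (scale_eq0 n24) | apply: (scale_eq0 n12)].
- suff -> : 12%:R *: a1 = 8%:R *: (p 1 - p (-1)) - (p 2%:R - p (- 2%:R)).
    by rewrite !p0 !subr0 scaler0.
  by rewrite /p; module_eq.
- suff -> : 24%:R *: a2 = 16%:R *: (p 1 + p (-1)) - (p 2%:R + p (- 2%:R)) - 30%:R *: p 0.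
    by rewrite !p0 !addr0 !scaler0 !subr0.
  by rewrite /p; module_eq.
- suff -> : 12%:R *: a3 = p 2%:R - p (- 2%:R) - 2%:R *: (p 1 - p (-1)).
    by rewrite !p0 !subr0 scaler0 subr0.
  by rewrite /p; module_eq.
Qed.

Variables (mul : {bilinear A -> A -> A}) (w : {scalar A}).
Hypothesis bern : bernstein mul w.

Let mulC : commutative mul. Proof. by case: bern => [[]]. Qed.
Let wM x y : w (mul x y) = w x * w y. Proof. by case: bern => [[_ []]]. Qed.

Lemma bernstein_idempotent x : w x = 1 -> mul (mul x x) (mul x x) = mul x x.
Proof. by move=> wx; case: bern => _ ->; rewrite wx expr1n scale1r. Qed.

Let mulDl x y z : mul (x + y) z = mul x z + mul y z. Proof. exact: linearDl. Qed.
Let mulDr x y z : mul x (y + z) = mul x y + mul x z. Proof. exact: linearD. Qed.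
Let mulZl (c : K) x y : mul (c *: x) y = c *: mul x y. Proof. exact: linearZl_LR. Qed.
Let mulZr (c : K) x y : mul x (c *: y) = c *: mul x y. Proof. exact: linearZ. Qed.
Let mul_simp := (mulDl, mulDr, mulZl, mulZr).

Section Idempotent.
Variable e : A.
Hypotheses (we : w e = 1) (ee : mul e e = e).

(** For x = e + ty of weight 1, compare the coefficients of t and t^2 in (x^2)^2 = x^2. The first
    relation says that e acts on N with eigenvalues 0 and 1/2. *)
Lemma bernstein_peirce y : w y = 0 ->
  2%:R *: mul e (mul e y) = mul e y /\
  4%:R *: mul (mul e y) (mul e y) + 2%:R *: mul e (mul y y) = mul y y.
Proof.
move=> wy; pose f := mul e y; pose q := mul y y.
case: (@quartic_coef 0 (4%:R *: mul e f - 2%:R *: f)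
   (4%:R *: mul f f + 2%:R *: mul e q - q) (4%:R *: mul f q) (mul q q)) => [t|E1 E2 _].
  have wx : w (e + t *: y) = 1 by rewrite linearD linearZ we wy /= mulr0 addr0.
  have sq : mul (e + t *: y) (e + t *: y) = e + (2%:R * t) *: f + t ^+ 2 *: q.
    by rewrite !mul_simp ee (mulC y e) -/f -/q; module_eq.
  have /eqP := bernstein_idempotent wx; rewrite sq -subr_eq0 => /eqP H; apply: etrans H.
  rewrite !mul_simp ee (mulC f e) (mulC q e) (mulC q f); module_eq.
split; last by apply/eqP; rewrite -subr_eq0; apply/eqP.
apply/eqP; rewrite -subr_eq0; apply/eqP/(scale_eq0 K2).
by apply: etrans E1; rewrite -/f; module_eq.
Qed.

(** The coefficients of t^2 and t^3 in x^3 = x^2 at x = e + ty. *)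
Lemma cube_peirce y : w y = 0 ->
    (forall x, w x = 1 -> mul (mul x x) x = mul x x) ->
  mul e (mul y y) + 2%:R *: mul (mul e y) y = mul y y /\ mul (mul y y) y = 0.
Proof.
move=> wy cube; pose f := mul e y; pose q := mul y y.
case: (@quartic_coef 0 (2%:R *: mul e f - f) (mul e q + 2%:R *: mul f y - q) (mul q y) 0) => [t|_ E2 E3].
  have wx : w (e + t *: y) = 1 by rewrite linearD linearZ we wy /= mulr0 addr0.
  have sq : mul (e + t *: y) (e + t *: y) = e + (2%:R * t) *: f + t ^+ 2 *: q.
    by rewrite !mul_simp ee (mulC y e) -/f -/q; module_eq.
  have /eqP := cube _ wx; rewrite sq -subr_eq0 => /eqP H; apply: etrans H.
  rewrite !mul_simp ee (mulC f e) (mulC q e) -/f; module_eq.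
by split=> //; apply/eqP; rewrite -subr_eq0; apply/eqP.
Qed.

End Idempotent.

Section Polarization.
Variable e : A.
Hypotheses (we : w e = 1) (ee : mul e e = e).
Hypothesis cube : forall x, w x = 1 -> mul (mul x x) x = mul x x.

Let wD0 x y : w x = 0 -> w y = 0 -> w (x + y) = 0.
Proof. by move=> wx wy; rewrite linearD /= wx wy addr0. Qed.

Lemma peirce_polar y z : w y = 0 -> w z = 0 ->
  4%:R *: mul (mul e y) (mul e z) + 2%:R *: mul e (mul y z) = mul y z.
Proof.
move=> wy wz; apply/eqP; rewrite -subr_eq0; apply/eqP/(scale_eq0 K2).
pose p x := 4%:R *: mul (mul e x) (mul e x) + 2%:R *: mul e (mul x x) - mul x x.
have p0 x : w x = 0 -> p x = 0.
  by move=> wx; rewrite /p (bernstein_peirce we ee wx).2 subrr.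
have : p (y + z) - p y - p z = 0 by rewrite !p0 ?subr0 //; apply: wD0.
apply: etrans; rewrite /p !mul_simp (mulC z y) (mulC (mul e z)); module_eq.
Qed.

Lemma cube_polar y z : w y = 0 -> w z = 0 ->
  mul e (mul y z) + mul (mul e y) z + mul (mul e z) y = mul y z.
Proof.
move=> wy wz; apply/eqP; rewrite -subr_eq0; apply/eqP/(scale_eq0 K2).
pose p x := mul e (mul x x) + 2%:R *: mul (mul e x) x - mul x x.
have p0 x : w x = 0 -> p x = 0.
  by move=> wx; rewrite /p (cube_peirce we ee wx cube).1 subrr.
have : p (y + z) - p y - p z = 0 by rewrite !p0 ?subr0 //; apply: wD0.
apply: etrans; rewrite /p !mul_simp (mulC z y); module_eq.
Qed.

Lemma nil_jacobi x y z : w x = 0 -> w y = 0 -> w z = 0 ->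
  mul x (mul y z) + mul y (mul x z) + mul z (mul x y) = 0.
Proof.
move=> wx wy wz; apply: (scale_eq0 K2); pose p x := mul (mul x x) x.
have p0 u : w u = 0 -> p u = 0 by move=> wu; apply: (cube_peirce we ee wu cube).2.
(* Inclusion-exclusion isolates the trilinear part of the cube, which is twice the wanted sum. *)
have : p (x + y + z) - p (x + y) - p (y + z) - p (x + z) + p x + p y + p z = 0.
  by rewrite !p0 ?subr0 ?addr0 //; do ?apply: wD0.
apply: etrans; rewrite /p !mul_simp.
rewrite (mulC y x) (mulC z x) (mulC z y) !(mulC (mul _ _)); module_eq.
Qed.

End Polarization.

Let wB x y : w (x - y) = w x - w y. Proof. exact: linearB. Qed.

(** With f = x^2 idempotent and h = x - f in N, x^3 = f + fh, so the claim is fh = 0. A dependency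
    among x, f and fx makes h an eigenvector of f or zero. *)
Lemma cube_eq_square x : degrees_le mul 2 -> w x = 1 -> mul (mul x x) x = mul x x.
Proof.
move=> deg2 wx; pose f := mul x x; pose h := x - f.
have wf : w f = 1 by rewrite wM wx mulr1.
have ff : mul f f = f by apply: bernstein_idempotent.
have wh : w h = 0 by rewrite wB wx wf subrr.
suff fh : mul f h = 0 by rewrite -/f -[x in mul _ x](subrK f) mulDr ff -/h fh add0r.
have [m [b [_ b_gen]] le_m2] := deg2 x.
pose c (i : 'I_3) := [:: x; f; mul f x]`_i.
have c_gen i : range (lincomb b) (c i).
  rewrite b_gen; move=> B [aB xB]; have Bx : B x by apply: xB.
  have aBM := (let: And3 _ _ aBM := aB in aBM).
  case: i => [[|[|[|k]]] lt_k3] //; rewrite /c /=; [exact: aBM | by apply: (aBM) => //; apply: aBM].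
have : ~ lin_indep c.
  by move=> /indep_leq /(_ c_gen) le_3m; have := leq_trans le_3m le_m2.
move=> /existsNP[d /not_implyP[dc0 /eqP nz_d]].
have {dc0} : d 0 0 *: x + d 0 1 *: f + d 0 (inord 2) *: mul f x = 0.
  rewrite -[RHS]dc0 /lincomb !big_ord_recl big_ord0 addr0 /c /= addrA.
  by congr (_ + d 0 _ *: _ + d 0 _ *: _); apply: val_inj; rewrite //= inordK.
have nz_d3 : [|| d 0 0 != 0, d 0 1 != 0 | d 0 (inord 2) != 0].
  apply: contraR nz_d; rewrite !negb_or !negbK => /and3P[/eqP d0 /eqP d1 /eqP d2].
  apply/eqP/rowP => i; rewrite mxE; case: i => [[|[|[|k]]] Hi //].
  - by rewrite -[RHS]d0; congr (d 0 _); apply: val_inj.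
  - by rewrite -[RHS]d1; congr (d 0 _); apply: val_inj.
  - by rewrite -[RHS]d2; congr (d 0 _); apply: val_inj; rewrite /= inordK.
move: (d 0 0) (d 0 1) (d 0 (inord 2)) nz_d3 => d0 d1 d2 nz_d3 dep.
(* All three vectors have weight 1. Eliminating d1 leaves a relation between h and fh. *)
have wd : d0 + d1 + d2 = 0.
  by have := congr1 w dep; rewrite !linearD !linearZ linear0 /= wM wx wf !mulr1.
have hdep : d2 *: mul f h = - d0 *: h.
  have d1E : d1 = - d0 - d2 by apply/eqP; rewrite -subr_eq0 -wd; apply/eqP; ring.
  apply/eqP; rewrite -subr_eq0 -dep d1E /h mulDr -scaleN1r mulZr ff; apply/eqP.
  module_eq.
have [d2_0|nz_d2] := eqVneq d2 0.
  have nz_d0 : - d0 != 0.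
    apply: contraTneq nz_d3 => /eqP; rewrite oppr_eq0 => /eqP d0_0.
    by move: wd; rewrite d2_0 d0_0 addr0 add0r => ->; rewrite eqxx.
  have /scale_eq0 -> // : - d0 *: h = 0 by rewrite -hdep d2_0 scale0r.
  by rewrite linear0.
pose a := - d0 / d2.
have fhE : mul f h = a *: h.
  by rewrite /a mulrC -scalerA -hdep scalerA mulVf // scale1r.
have [+ +] := bernstein_peirce wf ff wh.
(* Recorded before [clearbody] forgets how f and h come from x. *)
have xE : x = f + h by rewrite addrC subrK.
have fE : mul x x = f by [].
clearbody h f; rewrite !fhE !mul_simp fhE => ah0 ahh.
have [->|nz_h] := eqVneq h 0; first by rewrite scaler0.
have [->|nz_a] := eqVneq a 0; first by rewrite scale0r.
have a2 : 2%:R * a = 1.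
  apply/eqP; rewrite -subr_eq0; have /eqP : (a * (2%:R * a - 1)) *: h = 0.
    by apply: etrans (subrr (a *: h)); rewrite -{1}ah0; module_eq.
  by rewrite scaler_eq0 (negbTE nz_h) orbF mulf_eq0 (negbTE nz_a).
(* Since a = 1/2, x^2 = f + h + hh, to be compared with x^2 = f. *)
have hh : mul h h = - h.
  apply/eqP; rewrite -subr_eq0 opprK; apply/eqP/(addrI f).
  rewrite addr0 -[RHS]fE xE !mul_simp ff (mulC h f) fhE.
  by apply: etrans (_ : f + (2%:R * a) *: h + mul h h = _); [rewrite a2; module_eq | module_eq].
(* The quadratic Peirce relation becomes hh + 2 f(hh) = hh. With hh = -h this gives fh = 0. *)
have : mul f (mul h h) = 0.
  apply: (scale_eq0 K2); apply: (addrI (mul h h)); rewrite addr0 -[RHS]ahh; congr (_ + _).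
  have -> : 4%:R *: (a *: (a *: mul h h)) = (2%:R * a) *: ((2%:R * a) *: mul h h) by module_eq.
  by rewrite a2 !scale1r.
rewrite hh linearN /= => /eqP; rewrite oppr_eq0 => /eqP.
by rewrite fhE => ->.
Qed.

(** The Peirce components of the generators lie in a finite-dimensional subalgebra B of N; K e
    together with the part of B that e maps into B is then the whole algebra. *)
Lemma finite_dim_of_cube : (forall x, w x = 1 -> mul (mul x x) x = mul x x) ->
  finitely_generated mul -> finite_dim A.
Proof.
move=> cube [n [gs [_ _ gsA]]].
have [x0 nz_x0] : exists x, w x != 0 by case: bern => [[_ []]].
pose x1 := (w x0)^-1 *: x0; pose e := mul x1 x1.
have wx1 : w x1 = 1 by rewrite linearZ /= mulVf.
have we : w e = 1 by rewrite wM wx1 mulr1.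
have ee : mul e e = e by apply: bernstein_idempotent.
clearbody e; clear x1 wx1.
pose N := [set x | w x = 0].
pose U := [set x | w x = 0 /\ 2%:R *: mul e x = x].
pose V := [set x | w x = 0 /\ mul e x = 0].
have sN : subspace N.
  by split=> [|k x y Nx Ny]; rewrite /N /= ?linear0 // linearP Nx Ny /= mulr0 addr0.
have sU : subspace U.
  split=> [|k x y [wx ex] [wy ey]]; rewrite /U /= ?linear0 ?scaler0 //.
  by rewrite linearP wx wy /= mulr0 addr0 !mul_simp; split=> //; rewrite -[in RHS]ex -[in RHS]ey; module_eq.
have sV : subspace V.
  split=> [|k x y [wx ex] [wy ey]]; rewrite /V /= ?linear0 //.
  by rewrite linearP wx wy /= mulr0 addr0 !mul_simp ex ey scaler0 addr0.
have wxy x y : w x = 0 -> w (mul x y) = 0 by move=> wx; rewrite wM wx mul0r.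
have half (x y : A) : 2%:R *: x = y -> x = 2^-1 *: y by move=> <-; rewrite scalerA mulVf // scale1r.
have mulUU a b : U a -> U b -> V (mul a b).
  move=> [wa /half ea] [wb /half eb]; split; first exact: wxy.
  apply: (scale_eq0 K2); apply: (addrI (mul a b)); rewrite addr0.
  rewrite -[RHS](peirce_polar we ee wa wb) ea eb !mul_simp; congr (_ + _).
  by rewrite !scalerA (natrM _ 2 2) mulrA mulfK // mulfV // scale1r.
have mulVU v a : V v -> U a -> U (mul v a).
  move=> [wv ev] [wa _]; split; first exact: wxy.
  by rewrite -[RHS](peirce_polar we ee wv wa) ev linear0l scaler0 add0r.
have mulVV v v' : V v -> V v' -> mul v v' = 0.
  move=> [wv ev] [wv' ev'].
  (* The two relations read 2 e(vv') = vv' and e(vv') = vv', hence vv' = 0. *)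
  have E1 := peirce_polar we ee wv wv'; have E2 := cube_polar we ee cube wv wv'.
  move: E1 E2; rewrite ev ev' !linear0l scaler0 add0r !addr0 => E1 E2.
  by move: E1; rewrite E2 => E1; apply: (addrI (mul v v')); rewrite addr0 -[RHS]E1; module_eq.
have UN : U `<=` N by move=> x [].
have VN : V `<=` N by move=> x [].
(* Projection onto N along e; its image then splits as 2e(nu x) in U plus the rest in V. *)
pose nu x := x - w x *: e.
have nuN x : w (nu x) = 0 by rewrite wB linearZ /= we mulr1 subrr.
pose us := [seq 2%:R *: mul e (nu x) | x <- gs].
pose vs := [seq nu x - 2%:R *: mul e (nu x) | x <- gs].
have usU x : x \in us -> U x.
  move=> /mapP[g _ ->]; rewrite /U /= linearZ /= wM nuN !mulr0; split=> //.
  by rewrite mulZr (bernstein_peirce we ee (nuN g)).1.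
have vsV : lspan [set` vs] `<=` V.
  apply: lspan_sub => // _ /mapP[g _ ->]; rewrite /V /= wB linearZ /= wM nuN !mulr0 subr0.
  by split=> //; rewrite linearB /= mulZr (bernstein_peirce we ee (nuN g)).1 subrr.
have fdW : fd (lspan [set` vs]) by apply: fd_lspan; apply: fd_seq.
have jac x y z : N x -> N y -> N z ->
  mul x (mul y z) + mul y (mul x z) + mul z (mul x y) = 0 by apply: (nil_jacobi we ee cube).
have [B [aB BN fdB usB vsB]] := fd_subalgebra K2 K3 mulC sU sV sN UN VN
  mulUU mulVU mulVV jac usU (subspace_lspan _) vsV fdW.
have sB : subspace B by case: aB.
have aBM x y : B x -> B y -> B (mul x y) by case: aB => _ _; apply.
(* B need not be stable under e. Y is a subalgebra since 2 e(xy) = xy - 4 (ex)(ey), and it is stable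
   under e since e(ex) = (1/2) ex. *)
pose Y := [set x | B x /\ B (mul e x)].
have sY : subspace Y by apply: (subspaceI sB (subspace_preimage (mul e) sB)).
have aY x y : Y x -> Y y -> Y (mul x y).
  move=> [Bx Bex] [By Bey]; split; first exact: aBM.
  rewrite (_ : mul e _ = 2^-1 *: (mul x y - 4%:R *: mul (mul e x) (mul e y))).
    by apply: (subspaceZ _ sB); apply: (subspaceB sB); [|apply: (subspaceZ _ sB)]; apply: aBM.
  apply: half; rewrite -[in RHS](peirce_polar we ee (BN _ Bx) (BN _ By)).
  by rewrite addrC addKr.
pose E := [set k *: e | k in [set: K]].
have sE : subspace E.
  split=> [|k _ _ [a _ <-] [b _ <-]]; first by exists 0; rewrite ?scale0r.
  by exists (k * a + b) => //; module_eq.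
have sEY : subspace (sumset E Y) by apply: subspace_sumset.
suff EYT : [set: A] `<=` sumset E Y.
  apply: fd_has_dim; first by split.
  apply: fd_subset EYT _; apply: fd_sumset; last by apply: fd_subset fdB => x [].
  exists [:: e] => _ [k _ <-]; apply: (subspaceZ _ (subspace_lspan _)).
  by apply: sub_lspan => /=; rewrite mem_head.
rewrite -gsA; apply: smallest_sub.
  split; [by case: sEY | by case: sEY |].
  move=> _ _ [_ [k _ <-] [x Yx ->]] [_ [l _ <-] [y Yy ->]].
  have eY z : Y z -> Y (mul e z).
    move=> [Bz Bez]; split=> //.
    by rewrite (half _ _ (bernstein_peirce we ee (BN _ Bz)).1); apply: (subspaceZ _ sB).
  exists ((k * l) *: e); first by exists (k * l).
  exists (k *: mul e y + l *: mul e x + mul x y); last first.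
    by rewrite !mul_simp ee (mulC x e); module_eq.
  do !apply: (subspaceD sY); do ?apply: (subspaceZ _ sY); by [apply: eY | apply: aY].
move=> g /= gs_g; exists (w g *: e); first by exists (w g).
exists (nu g); last by rewrite /nu addrC subrK.
have Bu : B (2%:R *: mul e (nu g)) by apply: usB; apply: map_f.
have Bv : B (nu g - 2%:R *: mul e (nu g)).
  by apply: vsB; apply: sub_lspan; apply: (map_f (fun x => nu x - 2%:R *: mul e (nu x))).
split; first by rewrite -(subrK (2%:R *: mul e (nu g)) (nu g)); apply: (subspaceD sB).
by rewrite (half (mul e (nu g)) _ erefl); apply: (subspaceZ _ sB).
Qed.

End SmallDegree.

(** * Degrees of elements and train equations of rank at most 3 *)

Section Train.
Context {K : fieldType} {A : lmodType K}.
Hypotheses (K2 : 2%:R != 0 :> K) (K3 : 3%:R != 0 :> K).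
Variables (mul : {bilinear A -> A -> A}) (w : {scalar A}).

Lemma lspan_subalgebra (S : set A) :
  (forall x y, S x -> S y -> lspan S (mul x y)) -> is_subalgebra mul (lspan S).
Proof.
move=> mulS; have sS := subspace_lspan S.
split; [by case: sS | by case: sS |] => x y Sx; move: y; apply: lspan_sub.
  exact: (subspace_preimage (mul x) sS).
move=> y Sy; rewrite /preimage /=; move: x Sx; apply: lspan_sub; last by move=> x /mulS; apply.
split=> [|k a b Ha Hb] /=; first by rewrite linear0l; case: sS.
by rewrite linearPl; apply: sS.2.
Qed.

Lemma degree_leq (x : A) (s : seq A) :
    x \in s -> (forall y z, y \in s -> z \in s -> lspan [set` s] (mul y z)) ->
  exists2 m, algebraic_of_degree mul x m & (m <= size s)%N.
Proof.
move=> xs mul_s; apply: (subspace_has_dim (g := fun i : 'I_(size s) => s`_i)).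
  by apply: subspace_smallest => H [].
have aS : is_subalgebra mul (lspan [set` s]) by apply: lspan_subalgebra.
by move=> y Hy; apply: lspan_seq; apply: Hy; split=> // _ ->; apply: sub_lspan.
Qed.

Lemma min_degree n : (1 <= n)%N -> degrees_le mul n ->
  exists2 d, algebraic_of_bounded_degree mul d & (d <= n)%N.
Proof.
move=> n_gt0 deg_n; pose P d := (1 <= d)%N && `[< degrees_le mul d >].
have exP : exists d, P d by exists n; rewrite /P n_gt0; apply/asboolP.
case: (ex_minnP exP) => d /andP[d_gt0 /asboolP deg_d] min_d.
exists d; last by apply: min_d; rewrite /P n_gt0; apply/asboolP.
by split=> // k k_gt0 deg_k; apply: min_d; rewrite /P k_gt0; apply/asboolP.
Qed.

(** Both ranks are brought to one form: a rank 2 equation is multiplied by x. Only the dependency at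
    each single x matters later, so the coefficients are arbitrary functions of x. *)
Lemma train_cube r : (2 <= r <= 3)%N -> train_equation mul w r -> exists a b : A -> K,
  forall x, mul (mul x x) x = a x *: x + b x *: mul x x.
Proof.
move=> /andP[le2r ler3] [g Hg].
have /orP[/eqP r2|/eqP r3] : (r == 2) || (r == 3) by case: r le2r ler3 {Hg} => [|[|[|[|]]]].
  exists (fun=> 0), (fun x => - (g 1%N * w x)) => x; have := Hg x.
  rewrite r2 big_nat1 /ppow /= expr1 => /eqP; rewrite addr_eq0 -scaleNr => /eqP xx.
  by rewrite {1}xx linearZl_LR scale0r add0r.
exists (fun x => - (g 2%N * w x ^+ 2)), (fun x => - (g 1%N * w x)) => x; have := Hg x.
rewrite r3 big_nat_recr //= big_nat1 /ppow /= expr1 => /eqP; rewrite addr_eq0 => /eqP ->.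
module_eq.
Qed.

Hypothesis bern : bernstein mul w.

(** The span of x and x^2 is closed under products: x x^2 by [train_cube], and x^2 x^2 by the
    Bernstein identity. *)
Lemma train_degree r : (2 <= r <= 3)%N -> train_equation mul w r -> degrees_le mul 2.
Proof.
move=> r23 /(train_cube r23)[a [b cube]] x.
have mulC : commutative mul by case: bern => [[]].
have sq : mul (mul x x) (mul x x) = w x ^+ 2 *: mul x x by case: bern.
apply: (degree_leq (s := [:: x; mul x x])); first exact: mem_head.
have sS := subspace_lspan [set` [:: x; mul x x]].
have Sx : lspan [set` [:: x; mul x x]] x by apply: sub_lspan; apply: mem_head.
have Sxx : lspan [set` [:: x; mul x x]] (mul x x).
  by apply: sub_lspan; rewrite /= !inE eqxx orbT.
move=> y z; rewrite !inE => /orP[] /eqP -> /orP[] /eqP -> //.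
- by rewrite mulC cube; apply: (subspaceD sS); apply: (subspaceZ _ sS).
- by rewrite cube; apply: (subspaceD sS); apply: (subspaceZ _ sS).
- by rewrite sq; apply: (subspaceZ _ sS).
Qed.

Lemma finite_dim_of_degree2 : degrees_le mul 2 -> finitely_generated mul -> finite_dim A.
Proof.
move=> deg2; apply: (finite_dim_of_cube K2 K3 bern) => x.
exact: (cube_eq_square K2 K3 bern).
Qed.

End Train.

(** * Bernstein algebras with U^2 = 0 *)

Section SplitAlgebra.
Context {K : fieldType} {U : lmodType K}.
Variables (L1 L2 : {linear U -> U}) (p q : U).

Definition split_op (a b : K) (u : U) : U := a *: L1 u + b *: L2 u.

(* K e + K v + K w + U with e = 1/2 on U, where v and w act on U as L1 and L2, and
   v^2 = p, v w = q, w^2 = 0. *)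
Definition split_alg : Type := (K^o * K^o * K^o * U)%type.

HB.instance Definition _ := GRing.Lmodule.on split_alg.

Implicit Types x y : split_alg.

Definition split_mk (c a b : K) (u : U) : split_alg := (c, a, b, u).
Definition coe x : K := x.1.1.1.
Definition cov x : K := x.1.1.2.
Definition cow x : K := x.1.2.
Definition coU x : U := x.2.

Lemma split_ext x y : coe x = coe y -> cov x = cov y -> cow x = cow y ->
  coU x = coU y -> x = y.
Proof.
by case: x => [[[? ?] ?] ?]; case: y => [[[? ?] ?] ?]; rewrite /coe /cov /cow /coU /= => -> -> -> ->.
Qed.

Lemma coP k x y :
  (coe (k *: x + y) = k * coe x + coe y) * (cov (k *: x + y) = k * cov x + cov y) *
  (cow (k *: x + y) = k * cow x + cow y) * (coU (k *: x + y) = k *: coU x + coU y).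
Proof. by []. Qed.

Definition split_mul x y : split_alg :=
  split_mk (coe x * coe y) 0 0
    (2%:R^-1 *: (coe x *: coU y + coe y *: coU x)
     + split_op (cov x) (cow x) (coU y) + split_op (cov y) (cow y) (coU x)
     + (cov x * cov y) *: p + (cov x * cow y + cov y * cow x) *: q).

Lemma co_mul x y :
  (coe (split_mul x y) = coe x * coe y) * (cov (split_mul x y) = 0) *
  (cow (split_mul x y) = 0) *
  (coU (split_mul x y) =
     2%:R^-1 *: (coe x *: coU y + coe y *: coU x)
     + split_op (cov x) (cow x) (coU y) + split_op (cov y) (cow y) (coU x)
     + (cov x * cov y) *: p + (cov x * cow y + cov y * cow x) *: q).
Proof. by []. Qed.

Lemma split_mulC : commutative split_mul.
Proof. by move=> x y; apply: split_ext; rewrite ?co_mul; (try ring); module_eq. Qed.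

Lemma split_op_linear a b : linear (split_op a b).
Proof. by move=> k u v; rewrite /split_op (linearP L1) (linearP L2); module_eq. Qed.

HB.instance Definition _ a b :=
  GRing.isLinear.Build K U U *:%R (split_op a b) (split_op_linear a b).

Lemma split_mul_bilinear : bilinear_for *:%R *:%R split_mul.
Proof.
suff addl y : linear (split_mul^~ y).
  split=> [y|y k x x'] /=; first exact: addl.
  by rewrite !(split_mulC y); apply: addl.
move=> k x x' /=; apply: split_ext.
- by rewrite (coP k (split_mul x y)) !co_mul (coP k x); ring.
- by rewrite (coP k (split_mul x y)) !co_mul mulr0 addr0.
- by rewrite (coP k (split_mul x y)) !co_mul mulr0 addr0.
- rewrite (coP k (split_mul x y)) !co_mul !(coP k x x') split_op_linear /split_op.
  module_eq.
Qed.

HB.instance Definition _ :=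
  bilinear_isBilinear.Build K split_alg split_alg split_alg *:%R *:%R split_mul split_mul_bilinear.

Lemma coe_linear : linear_for *%R coe. Proof. by []. Qed.

HB.instance Definition _ := GRing.isLinear.Build K split_alg K *%R coe coe_linear.

Hypothesis K2 : 2%:R != 0 :> K.

(** x^2 has no component along v and w. For weight c and U-component t of x^2, its square is c^4 e +
    c^2 t, whatever [L1], [L2], [p] and [q] are. *)
Lemma split_bernstein : bernstein split_mul coe.
Proof.
split; first split; first exact: split_mulC.
  by split=> //; exists (split_mk 1 0 0 0); rewrite oner_eq0.
move=> x; have coZ k y : (coe (k *: y) = k * coe y) * (cov (k *: y) = k * cov y) *
  (cow (k *: y) = k * cow y) * (coU (k *: y) = k *: coU y) by [].
apply: split_ext; rewrite ?(coZ _ (split_mul x x)) ?co_mul ?mulr0 //; (try by ring).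
have op0 u : split_op 0 0 u = 0 by rewrite /split_op !scale0r addr0.
rewrite !op0; set t := (X in _ *: (_ *: X + _)).
have half (a : K) : 2%:R^-1 * (a + a) = a 
  by apply: (mulfI K2); rewrite mulrA mulfV // mul1r; ring.
by rewrite -scalerDl scalerA half -expr2 !addr0 !scale0r !addr0.
Qed.

End SplitAlgebra.

(** * Degrees, train equation and generators of the split algebras *)

Section SplitDegree.
Context {K : fieldType} {U : lmodType K}.
Hypothesis K2 : 2%:R != 0 :> K.
Variables (L1 L2 : {linear U -> U}) (p q : U).
Implicit Types x y : (@split_alg K U).
Local Notation mulS := (split_mul L1 L2 p q).
Local Notation opS := (split_op L1 L2).

Definition inU (u : U) : (@split_alg K U) := split_mk 0 0 0 u.

Lemma co_inU u :
  (coe (inU u) = 0) * (cov (inU u) = 0) * (cow (inU u) = 0) * (coU (inU u) = u).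
Proof. by []. Qed.

Lemma inUP k u u' : inU (k *: u + u') = k *: inU u + inU u'.
Proof. by apply: split_ext; rewrite ?(coP k (inU u)) //= mulr0 addr0. Qed.

Lemma split_mul_inU x u :
  mulS x (inU u) = inU ((2%:R^-1 * coe x) *: u + opS (cov x) (cow x) u).
Proof.
apply: split_ext; rewrite co_mul !co_inU ?mulr0 //.
rewrite /split_op; module_eq.
Qed.

Lemma split_mul_inUU u u' : mulS (inU u) (inU u') = 0.
Proof.
rewrite split_mul_inU /opS mulr0 !scale0r !addr0.
exact: split_ext.
Qed.

(* The component in U of x^3 - (coe x) x^2, whose other components vanish. *)
Definition split_tail x : U :=
  coU (mulS x (mulS x x)) - coe x *: coU (mulS x x).

(** [L] is the operator on U of the part z = av + bw of x, and [s] is z^2. *)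
Lemma split_tailE x : let L := opS (cov x) (cow x) in
  let s := cov x ^+ 2 *: p + (2%:R * cov x * cow x) *: q in
  split_tail x = 2%:R *: L (L (coU x)) + L s - (2%:R^-1 * coe x) *: s.
Proof.
move=> L s; rewrite /split_tail !co_mul /s.
have op0 u : opS 0 0 u = 0 by rewrite /split_op !scale0r addr0.
have LD u v : L (u + v) = L u + L v by apply: (linearD (opS _ _)).
have LZ k u : L (k *: u) = k *: L u by apply: (scalable_linear (split_op_linear _ _ _ _)).
rewrite op0 -/L !(LD, LZ); module_eq; exact: K2.
Qed.

Lemma iter_eq0 (f : U -> U) n m u : f 0 = 0 -> iter n f u = 0 -> (n <= m)%N -> iter m f u = 0.
Proof.
move=> f0 fn /subnK <-; rewrite iterD fn.
by elim: (m - n)%N => //= k ->.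
Qed.

(** Applying the power n - i of f kills the terms beyond i, while those before i vanish by
    induction. *)
Lemma iter_indep (f : {linear U -> U}) n u (d : 'I_n.+1 -> K) :
    iter n f u != 0 -> iter n.+1 f u = 0 -> \sum_i d i *: iter i f u = 0 ->
  forall i, d i = 0.
Proof.
move=> nz_n fn d0.
have dk k : \sum_i d i *: iter (k + i) f u = 0.
  elim: k => // k IHk; apply: etrans (_ : f (\sum_i d i *: iter (k + i) f u) = _).
    by rewrite linear_sum; apply: eq_bigr => i _; rewrite linearZ.
  by rewrite IHk linear0.
suff dlt k (i : 'I_n.+1) : (i < k)%N -> d i = 0 by move=> i; apply: (dlt i.+1).
elim: k i => // k IHk i; rewrite ltnS leq_eqVlt => /predU1P[ik|]; last exact: IHk.
have le_in : (i <= n)%N by rewrite -ltnS.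
have := dk (n - i)%N; rewrite (bigD1 i) //= subnK // big1 ?addr0 => [/eqP|j ne_ji].
  by rewrite scaler_eq0 (negbTE nz_n) orbF => /eqP.
have [lt_ji|le_ij] := ltnP j i; first by rewrite IHk -?ik ?scale0r.
have lt_ij : (i < j)%N by rewrite ltn_neqAle le_ij andbT eq_sym.
by rewrite (iter_eq0 (linear0 f) fn) ?scaler0 // -{1}(subnK le_in) ltn_add2l.
Qed.

Section Degree.
Variable x : (@split_alg K U).
Let L := opS (cov x) (cow x).
Let T i := inU (iter i L (split_tail x)).

Lemma split_mul_sq : mulS x (mulS x x) = coe x *: mulS x x + T 0.
Proof.
apply: split_ext; rewrite (coP (coe x) (mulS x x)) co_inU.
- by rewrite !co_mul addr0.
- by rewrite !co_mul mulr0 addr0.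
- by rewrite !co_mul mulr0 addr0.
- by rewrite /split_tail addrC subrK.
Qed.

Lemma split_mul_tail i : mulS x (T i) = (2%:R^-1 * coe x) *: T i + T i.+1.
Proof. by rewrite split_mul_inU inUP. Qed.

(** The span of x, x^2 and the first n vectors [T i] is closed: x sends [T i] into the span of [T i]
    and [T i.+1], x^2 acts on U as a scalar, and U^2 = 0. *)
Lemma split_degree_leq n : iter n L (split_tail x) = 0 ->
  exists2 m, algebraic_of_degree mulS x m & (m <= n.+2)%N.
Proof.
move=> Ln; pose y := mulS x x.
pose s := [:: x, y & [seq T i | i <- iota 0 n]].
have -> : n.+2 = size s by rewrite /= size_map size_iota.
have sS := subspace_lspan [set` s].
have Sx : lspan [set` s] x by apply: sub_lspan; apply: mem_head.
have Sy : lspan [set` s] y by apply: sub_lspan; rewrite /= !inE eqxx orbT.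
have ST i : lspan [set` s] (T i).
  case: (ltnP i n) => [lt_in|le_ni].
    apply: sub_lspan; rewrite /= !inE map_f ?orbT //.
    by rewrite mem_iota.
  by rewrite /T (iter_eq0 (linear0 _) Ln le_ni); case: sS.
have yT i : lspan [set` s] (mulS y (T i)).
  rewrite split_mul_inU /opS !scale0r !addr0.
  by rewrite -[_ *: _]addr0 inUP; apply: (sS.2 _ _ _ (ST i)); exact: sS.1.
have xT i : lspan [set` s] (mulS x (T i)).
  by rewrite split_mul_tail; apply: sS.2.
have xy : lspan [set` s] (mulS x y).
  by rewrite split_mul_sq; apply: sS.2.
apply: degree_leq; first exact: mem_head.
move=> a b; rewrite !inE => /or3P[/eqP->|/eqP->|/mapP[i _ ->]] /or3P[/eqP->|/eqP->|/mapP[j _ ->]] //.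
- exact: xT.
- by rewrite /= split_mulC.
- rewrite (split_bernstein L1 L2 p q K2).2; exact: (subspaceZ _ sS).
- exact: yT.
- by rewrite /= split_mulC; apply: xT.
- by rewrite /= split_mulC; apply: yT.
- by rewrite /= split_mul_inUU; apply: sS.1.
Qed.

(** The n + 3 vectors x, x^2, [T 0], ..., [T n] lie in the subalgebra generated by x. The
    v-coordinate isolates x, the weight then isolates x^2, and [iter_indep] handles the rest. *)
Lemma split_degree_geq n m : coe x != 0 -> cov x != 0 -> iter n L (split_tail x) != 0 ->
  iter n.+1 L (split_tail x) = 0 -> algebraic_of_degree mulS x m -> (n.+3 <= m)%N.
Proof.
move=> nz_c nz_v nzLn Ln [g [_ gx]]; pose y := mulS x x.
pose b (i : 'I_n.+3) := nth 0 [:: x, y & [seq T i | i <- iota 0 n.+1]] i.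
have bT i : b (lift ord0 (lift ord0 i)) = T i.
  by rewrite /b !lift0 -[LHS]/(nth 0 [seq T i | i <- iota 0 n.+1] i) (nth_map 0%N) ?size_iota // nth_iota.
apply: (indep_leq (b := b) (g := g)) => [d|i]; last first.
  rewrite gx => B [[B0 BD BM] Bx]; have {}Bx : B x by apply: Bx.
  have sB : subspace B by split.
  have By : B y by apply: BM.
  have BT j : B (T j).
    elim: j => [|j IHj].
      have -> : T 0 = mulS x y - coe x *: y by rewrite split_mul_sq addrC addKr.
      by apply: (subspaceB sB); [apply: BM | apply: (subspaceZ _ sB)].
    have -> : T j.+1 = mulS x (T j) - (2%:R^-1 * coe x) *: T j.
      by rewrite split_mul_tail addrC addKr.
    by apply: (subspaceB sB); [apply: BM | apply: (subspaceZ _ sB)].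
  case: (unliftP ord0 i) => [j|] -> //.
  by case: (unliftP ord0 j) => [k|] -> //; rewrite bT.
rewrite /lincomb big_ord_recl big_ord_recl.
pose dT (i : 'I_n.+1) := d 0 (lift ord0 (lift ord0 i)).
have -> : \sum_(i < n.+1) d 0 (lift ord0 (lift ord0 i)) *: b (lift ord0 (lift ord0 i)) =
    inU (\sum_i dT i *: iter i L (split_tail x)).
  have inU_lin : {morph inU : u v / u + v >-> u + v}.
    by move=> u v; have := inUP 1 u v; rewrite !scale1r.
  rewrite (big_morph inU inU_lin (erefl _ : inU 0 = 0)).
  apply: eq_bigr => i _; rewrite bT /dT.
  by have := inUP (dT i) (iter i L (split_tail x)) 0; rewrite !addr0.
set v := \sum_i _; rewrite {1}/b /= => dep.
have d0 : d 0 ord0 = 0.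
  have := congr1 cov dep; rewrite !coP co_mul /= mulr0 !addr0 => /eqP.
  by rewrite mulf_eq0 (negbTE nz_v) orbF => /eqP.
move: dep; rewrite d0 scale0r add0r => dep.
have d1 : d 0 (lift ord0 ord0) = 0.
  have := congr1 coe dep; rewrite !coP co_mul /= addr0 => /eqP.
  by rewrite !mulf_eq0 (negbTE nz_c) !orbF => /eqP.
move: dep; rewrite d1 scale0r add0r => /(congr1 coU) /= v0.
have dT0 := iter_indep nzLn Ln v0.
apply/rowP => i; rewrite mxE; case: (unliftP ord0 i) => [j|] -> //.
by case: (unliftP ord0 j) => [k|] -> //; apply: dT0.
Qed.

End Degree.

(** x^3 = c x^2 + T and xT = (c/2) T, so the train polynomial is X^2 (X - 1)(X - 1/2). *)
Lemma split_train : (forall x, opS (cov x) (cow x) (split_tail x) = 0) ->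
  train_equation mulS coe 4.
Proof.
move=> L0; exists (fun i => [:: 0; - (3%:R / 2%:R); 2%:R^-1]`_i) => x.
do 3!rewrite big_ltn //; rewrite big_geq // addr0 /ppow /=.
rewrite [mulS (mulS x x) x]split_mulC [mulS _ x]split_mulC split_mul_sq.
set T0 := inU _; set y := mulS x x; set c := coe x.
have -> : mulS x (c *: y + T0) = c *: (c *: y + T0) + (2%:R^-1 * c) *: T0.
  have -> : mulS x (c *: y + T0) = c *: mulS x y + mulS x T0.
    exact: (split_mul_bilinear L1 L2 p q).2.
  by rewrite split_mul_sq (split_mul_tail x 0) /= L0 addr0.
module_eq; exact: K2.
Qed.

Lemma co_mk (c a b : K) (u : U) :
  (coe (split_mk c a b u) = c) * (cov (split_mk c a b u) = a) *
  (cow (split_mk c a b u) = b) * (coU (split_mk c a b u) = u).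
Proof. by []. Qed.

(** The two generators are e + w and v: (e + w)^2 = e gives w by difference, v^2 = p and vw = q. *)
Lemma split_gen (B : set (@split_alg K U)) : is_subalgebra mulS B ->
    B (split_mk 1 0 1 0) -> B (split_mk 0 1 0 0) ->
  [/\ B (split_mk 1 0 0 0), B (split_mk 0 0 1 0), B (inU p), B (inU q) &
      forall u, B (inU u) -> B (inU (L1 u)) /\ B (inU (L2 u))].
Proof.
move=> [B0 BD BM] Bg Bv; have sB : subspace B by split.
pose simp := (mulr0, mul0r, mulr1, scaler0, scale0r, scale1r, addr0, add0r).
have opu0 a b : opS a b 0 = 0 by rewrite /split_op (linear0 L1) (linear0 L2) !scaler0 addr0.
have Be : B (split_mk 1 0 0 0).
  have -> : split_mk 1 0 0 0 = mulS (split_mk 1 0 1 0) (split_mk 1 0 1 0); last exact: BM.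
  apply: split_ext; rewrite co_mul !co_mk ?mulr1 //.
  by rewrite !opu0 !simp.
have Bw : B (split_mk 0 0 1 0).
  have -> : split_mk 0 0 1 0 = -1 *: split_mk 1 0 0 0 + split_mk 1 0 1 0 :> @split_alg K U.
    apply: split_ext; rewrite (coP (-1) (split_mk 1 0 0 0)) !co_mk ?mulr0 ?add0r ?mulr1 ?addNr //.
    by rewrite scaler0 addr0.
  exact: BD.
have Bp : B (inU p).
  have -> : inU p = mulS (split_mk 0 1 0 0) (split_mk 0 1 0 0); last exact: BM.
  apply: split_ext; rewrite co_mul !co_mk ?mulr0 //.
  by rewrite !opu0 !simp.
have Bq : B (inU q).
  have -> : inU q = mulS (split_mk 0 1 0 0) (split_mk 0 0 1 0); last exact: BM.
  apply: split_ext; rewrite co_mul !co_mk ?mulr0 //.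
  by rewrite !opu0 !simp.
split=> // u Bu; split.
  have -> : inU (L1 u) = mulS (split_mk 0 1 0 0) (inU u); last exact: BM.
  by rewrite split_mul_inU !co_mk mulr0 !scale0r add0r /split_op scale1r scale0r addr0.
have -> : inU (L2 u) = mulS (split_mk 0 0 1 0) (inU u); last exact: BM.
by rewrite split_mul_inU !co_mk mulr0 !scale0r add0r /split_op scale1r scale0r add0r.
Qed.

Lemma split_exists
    (P : forall A : lmodType K, {bilinear A -> A -> A} -> {scalar A} -> Prop) :
  P _ mulS coe -> exists A mul w, P A mul w.
Proof. by move=> HP; exists (@split_alg K U : lmodType K), mulS, coe. Qed.

End SplitDegree.

(** * An infinite-dimensional example *)

Lemma linear_comb3 (K : fieldType) (V : lmodType K) (f : V -> V) (k l : K) (u v z : V) :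
  linear f -> f (k *: u + v - l *: z) = - l *: f z + (k *: f u + f v).
Proof. by move=> lin_f; rewrite addrC -scaleNr !lin_f. Qed.

Section LadderModule.
Context {K : fieldType} {m : nat}.
Hypothesis K2 : 2%:R != 0 :> K.

Local Notation ladder := ({poly K} * {poly K} * {poly K} * 'rV[K]_m)%type.

(** The index is a natural number and the row is 0 from [m] on, so shifting needs no boundary case
    and [m] may be 0. *)
Definition unit_row (i : nat) : 'rV[K]_m := \row_j (j == i :> nat)%:R.

Definition shift : 'M[K]_m := \matrix_(i, j) (j == i.+1 :> nat)%:R.

(* The three polynomials carry the pencil [[0,a,0],[b,0,a],[0,-b,0]] (in reverse
   order), with 'X to make the iterated action infinite-dimensional; the row vector
   is the nilpotent tail, reached from the constant term of the third polynomial. *)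
Definition ladder_v (u : ladder) : ladder :=
  (0, u.1.1.1, 'X * u.1.1.2, u.2 *m shift + (u.1.2)`_0 *: unit_row 0).

Definition ladder_w (u : ladder) : ladder :=
  (- ('X * u.1.1.2), u.1.2, 0, 0).

Lemma ladder_v_linear : linear ladder_v.
Proof.
move=> k [[[a b] c] f] [[[a' b'] c'] f']; rewrite /ladder_v /=.
change ((0 : {poly K}, k *: a + a', 'X * (k *: b + b'),
    (k *: f + f') *m shift + (k *: c + c')`_0 *: unit_row 0) =
  (k *: (0 : {poly K}) + 0, k *: a + a', k *: ('X * b) + 'X * b',
    k *: (f *m shift + c`_0 *: unit_row 0) + (f' *m shift + c'`_0 *: unit_row 0))).
congr (_, _, _, _); first by rewrite scaler0 addr0.
  by rewrite mulrDr scalerAr.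
by rewrite coefD coefZ mulmxDl -scalemxAl scalerDl scalerDr scalerA addrACA.
Qed.

Lemma ladder_w_linear : linear ladder_w.
Proof.
move=> k [[[a b] c] f] [[[a' b'] c'] f']; rewrite /ladder_w /=.
change ((- ('X * (k *: b + b')), k *: c + c', 0 : {poly K}, 0 : 'rV[K]_m) =
  (k *: - ('X * b) - 'X * b', k *: c + c', k *: (0 : {poly K}) + 0, k *: (0 : 'rV[K]_m) + 0)).
by congr (_, _, _, _); rewrite ?scaler0 ?addr0 // mulrDr opprD scalerN scalerAr.
Qed.

HB.instance Definition _ :=
  GRing.isLinear.Build K ladder ladder *:%R ladder_v ladder_v_linear.
HB.instance Definition _ :=
  GRing.isLinear.Build K ladder ladder *:%R ladder_w ladder_w_linear.

(** With these values z = av + bw has z^2 = (-ab, 0, a^2, 0), which the pencil sends into the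
    tail. *)
Definition ladder_p : ladder := (0, 0, 1, 0).
Definition ladder_q : ladder := ((- 2%:R^-1)%:P, 0, 0, 0).

Local Notation L := (split_op ladder_v ladder_w).
Local Notation mulL := (split_mul ladder_v ladder_w ladder_p ladder_q).
Local Notation algL := (@split_alg K ladder).

Definition in_tail (f : 'rV[K]_m) : ladder := (0, 0, 0, f).

Lemma ladder_opE a b (x y z : {poly K}) f : L a b (x, y, z, f) =
  (- (b *: ('X * y)), a *: x + b *: z, a *: ('X * y),
   a *: (f *m shift + z`_0 *: unit_row 0)).
Proof.
rewrite /split_op.
change ((a *: 0 + b *: (- ('X * y)), a *: x + b *: z, a *: ('X * y) + b *: 0,
  a *: (f *m shift + z`_0 *: unit_row 0) + b *: (0 : 'rV[K]_m)) =
  (- (b *: ('X * y)), a *: x + b *: z, a *: ('X * y),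
   a *: (f *m shift + z`_0 *: unit_row 0))).
by rewrite !scaler0 !addr0 add0r scalerN.
Qed.

Lemma in_tailP k f g : in_tail (k *: f + g) = k *: in_tail f + in_tail g.
Proof.
rewrite /in_tail.
change ((0, 0, 0, k *: f + g) =
  (k *: (0 : {poly K}) + 0, k *: (0 : {poly K}) + 0, k *: (0 : {poly K}) + 0, k *: f + g)).
by rewrite scaler0 addr0.
Qed.

Lemma ladder_op_tail a b f : L a b (in_tail f) = in_tail (a *: (f *m shift)).
Proof. by rewrite /in_tail ladder_opE mulr0 !scaler0 oppr0 addr0 coef0 scale0r addr0. Qed.

Lemma shift_row (f : 'rV[K]_m) (k : nat) : (forall j : 'I_m, (j < k)%N -> f 0 j = 0) ->
  forall j : 'I_m, (j < k.+1)%N -> (f *m shift) 0 j = 0.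
Proof.
move=> fk j lt_jk; rewrite mxE big1 // => i _; rewrite mxE.
have [lt_ik|le_ki] := ltnP i k; first by rewrite fk ?mul0r.
by rewrite ltn_eqF ?mulr0 // (leq_trans lt_jk).
Qed.

(** Each step makes one more leading coordinate vanish. *)
Lemma iter_tail_eq0 a b f : iter m (L a b) (in_tail f) = 0.
Proof.
have iter_tail k : exists2 g, iter k (L a b) (in_tail f) = in_tail g &
    forall j : 'I_m, (j < k)%N -> g 0 j = 0.
  elim: k => [|k [g IHk gk]]; first by exists f.
  exists (a *: (g *m shift)); first by rewrite iterS IHk ladder_op_tail.
  by move=> j lt_jk; rewrite mxE (shift_row gk) ?mulr0.
have [g -> gm] := iter_tail m.
by have -> : g = 0 by apply/rowP => j; rewrite gm ?mxE.
Qed.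

(** In [split_tailE], applying L once more gives terms in L^3, L(L s) and L s; modulo the tail L^3 =
    0 and L s = 0. *)
Lemma ladder_tail (x : algL) : let Lx := L (cov x) (cow x) in
  exists f, Lx (split_tail ladder_v ladder_w ladder_p ladder_q x) = in_tail f.
Proof.
move=> Lx; rewrite split_tailE // -/Lx; set s := _ + _ *: ladder_q.
pose F := [set u | exists f, u = in_tail f].
have F0 : F 0 by exists 0.
have FD k u v : F u -> F v -> F (k *: u + v).
  by move=> [f ->] [g ->]; exists (k *: f + g); rewrite in_tailP.
have FL u : F u -> F (Lx u).
  by move=> [f ->]; exists (cov x *: (f *m shift)); apply: ladder_op_tail.
have Fmk (a b c : {poly K}) g : a = 0 -> b = 0 -> c = 0 -> F (a, b, c, g).
  by move=> -> -> ->; exists g.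
have L3 u : F (Lx (Lx (Lx u))).
  case: u => [[[a b] c] f]; rewrite /Lx (ladder_opE _ _ a b c f).
  rewrite (ladder_opE _ _ (- (cow x *: ('X * b))) (cov x *: a + cow x *: c)) ladder_opE.
  by apply: Fmk; rewrite -!mul_polyC; ring.
have Ls : F (Lx s).
  have -> : s = ((2%:R * cov x * cow x) *: (- 2%:R^-1)%:P, 0, (cov x ^+ 2) *: 1, 0).
    rewrite /s /ladder_p /ladder_q.
    change ((cov x ^+ 2 *: 0 + (2%:R * cov x * cow x) *: (- 2%:R^-1)%:P,
      cov x ^+ 2 *: (0 : {poly K}) + (2%:R * cov x * cow x) *: (0 : {poly K}),
      cov x ^+ 2 *: 1 + (2%:R * cov x * cow x) *: (0 : {poly K}),
      cov x ^+ 2 *: 0 + (2%:R * cov x * cow x) *: 0) =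
     ((2%:R * cov x * cow x) *: (- 2%:R^-1)%:P, 0 : {poly K}, (cov x ^+ 2) *: (1 : {poly K}),
      0 : 'rV[K]_m)).
    by rewrite !scaler0 !addr0 !add0r.
  rewrite /Lx ladder_opE; apply: Fmk.
  - by rewrite mulr0 scaler0 oppr0.
  - rewrite alg_polyC -!mul_polyC -!polyCM -polyCD.
    by have -> : cov x * (2%:R * cov x * cow x * - 2%:R^-1) + cow x * cov x ^+ 2 = 0 by field.
  - by rewrite mulr0 scaler0.
rewrite /Lx (linear_comb3 _ _ _ _ _ (split_op_linear ladder_v ladder_w (cov x) (cow x))).
by apply: (FD _ _ _ Ls); apply: (FD _ _ _ (L3 _)); apply: FL.
Qed.

(** One step to enter the tail and m steps to exhaust it. *)
Lemma ladder_tail_nil (x : algL) :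
  iter m.+1 (L (cov x) (cow x)) (split_tail ladder_v ladder_w ladder_p ladder_q x) = 0.
Proof. by have [f Ef] := ladder_tail x; rewrite iterSr Ef iter_tail_eq0. Qed.

Lemma unit_row_shift i : unit_row i *m shift = unit_row i.+1.
Proof.
apply/rowP => j; rewrite !mxE; have [lt_im|le_mi] := ltnP i m; last first.
  have lt_ji : (j < i.+1)%N by rewrite (leq_trans (ltn_ord j)) // (leq_trans le_mi).
  rewrite [in RHS]ltn_eqF // big1 // => k _.
  by rewrite mxE ltn_eqF ?mul0r // (leq_trans (ltn_ord k)).
rewrite (bigD1 (Ordinal lt_im)) //= !mxE eqxx mul1r big1 ?addr0 // => k ne_ki.
by rewrite mxE (negbTE (_ : k != i :> nat)) ?mul0r.
Qed.

(** The element e + v, which attains the maximal degree. *)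
Definition ladder_x : algL := split_mk 1 1 0 0.

Lemma ladder_tail_neq0 :
  iter m (L 1 0) (split_tail ladder_v ladder_w ladder_p ladder_q ladder_x) != 0.
Proof.
have -> : split_tail ladder_v ladder_w ladder_p ladder_q ladder_x =
    (0, 0, - (2%:R^-1)%:P, unit_row 0).
  rewrite split_tailE //.
  have -> : cov ladder_x ^+ 2 *: ladder_p + (2%:R * cov ladder_x * cow ladder_x) *: ladder_q
      = ladder_p by rewrite mulr0 scale0r addr0 expr1n scale1r.
  have -> : coU ladder_x = 0 by [].
  have op0 : L (cov ladder_x) (cow ladder_x) 0 = 0.
    exact: (linear0 (split_op ladder_v ladder_w (cov ladder_x) (cow ladder_x))).
  rewrite !op0 scaler0 add0r mulr1 (ladder_opE _ _ 0 0 1 0) /ladder_p.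
  change ((- (0 *: ('X * 0)) - 2%:R^-1 *: (0 : {poly K}),
     1 *: (0 : {poly K}) + 0 *: (1 : {poly K}) - 2%:R^-1 *: (0 : {poly K}),
     1 *: ('X * 0) - 2%:R^-1 *: (1 : {poly K}),
     1 *: ((0 : 'rV[K]_m) *m shift + (1 : {poly K})`_0 *: unit_row 0) - 2%:R^-1 *: (0 : 'rV[K]_m))
   = (0, 0, - (2%:R^-1)%:P, unit_row 0)).
  congr (_, _, _, _).
  - by rewrite mulr0 !scaler0 subr0 oppr0.
  - by rewrite !scaler0 scale0r addr0 subr0.
  - by rewrite mulr0 scaler0 sub0r alg_polyC.
  - by rewrite mul0mx add0r coef1 !scale1r scaler0 subr0.
have iterE i : iter i.+1 (L 1 0) (0, 0, - (2%:R^-1)%:P, unit_row 0) =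
    in_tail (unit_row i.+1 - 2%:R^-1 *: unit_row i).
  elim: i => [|i IHi].
    rewrite /= ladder_opE /in_tail; congr (_, _, _, _).
    + by rewrite scale0r oppr0.
    + by rewrite scaler0 scale0r addr0.
    + by rewrite mulr0 scaler0.
    + by rewrite scale1r unit_row_shift coefN coefC /= scaleNr.
  rewrite iterS IHi ladder_op_tail scale1r mulmxBl -scalemxAl.
  by rewrite !unit_row_shift.
(* The exponent is separated from [m], so that case analysis leaves the row type unchanged. *)
suff nz k : k = m -> iter k (L 1 0) (0, 0, - (2%:R^-1)%:P, unit_row 0) != 0 by apply: nz.
case: k => [_|k km].
  apply/eqP => /(congr1 (fun u : ladder => u.1.2)) /eqP.
  by rewrite oppr_eq0 polyC_eq0 invr_eq0 (negbTE K2).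
have lt_km : (k < m)%N by rewrite -km.
rewrite iterE; apply/eqP => /(congr1 (fun u : ladder => u.2 0 (Ordinal lt_km))) /eqP.
by rewrite !mxE /= eqxx mulr1 ltn_eqF // sub0r oppr_eq0 invr_eq0 (negbTE K2).
Qed.

Lemma ladder_generate (B : set algL) : is_subalgebra mulL B ->
  B (split_mk 1 0 1 0) -> B (split_mk 0 1 0 0) -> forall x, B x.
Proof.
move=> aB Bg Bv; have [B0 BD BM] := aB; have sB : subspace B by split.
have [Be Bw Bp Bq BL] := split_gen aB Bg Bv.
pose BU := [set u | B (inU u)].
have sBU : subspace BU by split=> // k u v Bu Bu'; rewrite /BU /= inUP; apply: BD.
have BV u v : BU u -> ladder_v u = v -> BU v by move=> /BL[Bu _] <-.
have BW u v : BU u -> ladder_w u = v -> BU v by move=> /BL[_ Bu] <-.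
have BUc (c : K) : BU (c%:P, 0, 0, 0).
  have -> : (c%:P, 0, 0, 0) = (- (2%:R * c)) *: ladder_q :> ladder.
    rewrite /ladder_q.
    change ((c%:P, 0, 0, 0) = ((- (2%:R * c)) *: (- 2%:R^-1)%:P, (- (2%:R * c)) *: 0,
      (- (2%:R * c)) *: 0, (- (2%:R * c)) *: 0) :> ladder).
    rewrite !scaler0 -mul_polyC -polyCM mulrNN; congr (_%:P, _, _, _).
    by rewrite mulrAC mulfV ?mul1r.
  exact: (subspaceZ _ sBU).
have BUy b : BU (b, 0, 0, 0) -> BU (0, b, 0, 0).
  move=> /BV; apply; congr (_, _, _, _); first by rewrite mulr0.
  by rewrite mul0mx coef0 scale0r addr0.
(* Applying v and then w multiplies the first polynomial by -X; constants come from q. *)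
have BUx a : BU (a, 0, 0, 0).
  elim/poly_ind: a => [|a c IHa]; first exact: sBU.1.
  have -> : (a * 'X + c%:P, 0, 0, 0) = -1 *: (- ('X * a), 0, 0, 0) + (c%:P, 0, 0, 0) :> ladder.
    change ((a * 'X + c%:P, 0, 0, 0) = (-1 *: - ('X * a) + c%:P, -1 *: 0 + 0,
      -1 *: 0 + 0, -1 *: 0 + 0) :> ladder).
    by rewrite !scaler0 !addr0 scaleN1r opprK commr_polyX.
  by apply: sBU.2 => //; apply: BW (BUy _ IHa) _.
(* Applying v twice to (c, 0, 0, 0) gives (0, 0, Xc, 0); constants come from p. *)
have BUz c : BU (0, 0, c, 0).
  elim/poly_ind: c => [|c k _]; first exact: sBU.1.
  have -> : (0, 0, c * 'X + k%:P, 0) = k *: ladder_p + (0, 0, 'X * c, 0) :> ladder.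
    rewrite /ladder_p.
    change ((0, 0, c * 'X + k%:P, 0) = (k *: 0 + 0, k *: 0 + 0, k *: 1 + 'X * c,
       k *: 0 + 0) :> ladder).
    by rewrite !scaler0 !addr0 alg_polyC addrC commr_polyX.
  apply: sBU.2 => //; apply: BV (BUy _ (BUx c)) _; congr (_, _, _, _).
  by rewrite mul0mx coef0 scale0r addr0.
(* v sends p to the first unit row and then shifts along the tail. *)
have BUf f : BU (in_tail f).
  have BUi i : BU (in_tail (unit_row i)).
    elim: i => [|i IHi].
      apply: BV Bp _; congr (_, _, _, _); first by rewrite mulr0.
      by rewrite mul0mx add0r coef1 scale1r.
    apply: BV IHi _; congr (_, _, _, _); first by rewrite mulr0.
    by rewrite coef0 scale0r addr0 unit_row_shift.
  have sBf : subspace [set f | BU (in_tail f)].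
    split=> [|k g h Bg' Bh]; first exact: sBU.1.
    by rewrite /= in_tailP; apply: sBU.2.
  have -> : f = \sum_j f 0 j *: unit_row j.
    apply/rowP => k; rewrite summxE (bigD1 k) //= !mxE eqxx mulr1 big1 ?addr0 // => j ne_jk.
    by rewrite !mxE eq_sym (negbTE (ne_jk : j != k :> nat)) mulr0.
  by apply: (subspace_sum sBf) => j; apply: (subspaceZ _ sBf); apply: BUi.
have BUT u : BU u.
  case: u => [[[a b] c] f].
  have -> : (a, b, c, f) = (a, 0, 0, 0) + ((0, b, 0, 0) + ((0, 0, c, 0) + in_tail f)) :> ladder.
    rewrite /in_tail; change ((a, b, c, f) = (a + (0 + (0 + 0)), 0 + (b + (0 + 0)),
      0 + (0 + (c + 0)), 0 + (0 + (0 + f))) :> ladder).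
    by rewrite !addr0 !add0r.
  by do !apply: (subspaceD sBU) => //; apply: BUy.
move=> x.
have -> : x = coe x *: split_mk 1 0 0 0 + (cov x *: split_mk 0 1 0 0 +
    (cow x *: split_mk 0 0 1 0 + inU (coU x))).
  by apply: split_ext; rewrite !(coP _ (split_mk _ _ _ _)) !co_mk
    ?mulr1 ?mulr0 ?scaler0 ?addr0 ?add0r.
by do 3!(apply: (BD) => //); apply: BUT.
Qed.

(** The powers of X in the first polynomial are independent. *)
Lemma ladder_infinite_dim : ~ finite_dim algL.
Proof.
case=> n [b [_ b_gen]].
pose g (i : 'I_n.+1) : algL := inU ('X^i, 0, 0, 0).
suff : (n.+1 <= n)%N by rewrite ltnn.
apply: (indep_leq (b := g) (g := b)) => [c|i]; last by rewrite b_gen.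
move=> /(congr1 (fun x : algL => (coU x).1.1.1)).
pose fX (x : algL) := (coU x).1.1.1.
rewrite -[LHS]/(fX _) /lincomb (big_morph fX (fun _ _ => erefl) (erefl : fX 0 = 0)).
move=> c0; apply/rowP => i; rewrite mxE; have /(congr1 (coefp i)) := c0.
rewrite /= coef0 coef_sum.
rewrite (bigD1 i) //= big1 => [|j ne_ji].
  by rewrite -[fX _]/(c 0 i *: 'X^i) coefZ coefXn eqxx mulr1 addr0 => ->.
by rewrite -[fX _]/(c 0 j *: 'X^j) coefZ coefXn eq_sym (negbTE (ne_ji : j != i :> nat)) mulr0.
Qed.

Lemma ladder_generated n : (2 <= n)%N -> generated_by mulL n.
Proof.
move=> le2n.
(* The first two elements already generate; n - 2 distinct monomials bring the count to n. *)
exists [:: split_mk 1 0 1 0, split_mk 0 1 0 0 &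
  [seq inU ('X^i, 0, 0, 0) : algL | i <- iota 0 (n - 2)]].
split.
- rewrite /= inE negb_or -andbA; apply/and4P; split.
  + by apply/eqP => /(congr1 coe) /eqP; rewrite oner_eq0.
  + by apply/mapP => -[i _ /(congr1 coe) /eqP]; rewrite oner_eq0.
  + by apply/mapP => -[i _ /(congr1 cov) /eqP]; rewrite oner_eq0.
  + rewrite map_inj_uniq ?iota_uniq // => i j.
    move=> /(congr1 (fun x : algL => size (coU x).1.1.1)) /=.
    by rewrite !size_polyXn => -[].
- by rewrite /= size_map size_iota -addn2 subnK.
- apply/seteqP; split=> // x _ B [aB sB].
  by apply: (ladder_generate aB); apply: sB => /=; rewrite !inE eqxx ?orbT.
Qed.

Lemma ladder_degree : algebraic_of_bounded_degree mulL m.+3.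
Proof.
split=> // [x|n _ /(_ ladder_x)[k]].
  exact: split_degree_leq (ladder_tail_nil x).
move=> /split_degree_geq; move=> /(_ m) H; apply: leq_trans; apply: H => //.
- by rewrite oner_eq0.
- by rewrite oner_eq0.
- exact: ladder_tail_neq0.
- exact: (ladder_tail_nil ladder_x).
Qed.

(** Without a tail, L annihilates [split_tail x] for every x. *)
Lemma ladder_train : m = 0%N -> train_equation mulL coe 4.
Proof.
move=> m0; apply: split_train => // x; have [f ->] := ladder_tail x.
have -> : f = 0 by apply/rowP => -[j lt_jm]; exfalso; rewrite m0 in lt_jm.
by [].
Qed.

Lemma ladder_exists n : (2 <= n)%N ->
  exists (A : lmodType K) (mul : {bilinear A -> A -> A}) (w : {scalar A}),
    [/\ bernstein mul w, generated_by mul n, algebraic_of_bounded_degree mul m.+3,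
        ~ finite_dim A & m = 0%N -> train_equation mul w 4].
Proof.
move=> le2n; apply: (@split_exists _ ladder ladder_v ladder_w ladder_p ladder_q
  (fun A mul w => [/\ bernstein mul w, generated_by mul n,
     algebraic_of_bounded_degree mul m.+3, ~ finite_dim A &
     m = 0%N -> train_equation mul w 4])).
split.
- exact: split_bernstein.
- exact: ladder_generated.
- exact: ladder_degree.
- exact: ladder_infinite_dim.
- exact: ladder_train.
Qed.

End LadderModule.

(** * Finiteness up to degree 2, and infinite-dimensional examples beyond *)

Theorem theorem0p4 (K : fieldType)
    (K_infinite : infinite_set [set: K])
    (K_char2 : 2%N \notin [pchar K]) (K_char3 : 3%N \notin [pchar K]) :
  [/\ (forall (A : lmodType K) (mul : {bilinear A -> A -> A}) (w : {scalar A}),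
         bernstein mul w -> finitely_generated mul ->
         (exists2 d, algebraic_of_bounded_degree mul d & (d <= 2)%N) ->
         finite_dim A),
      (forall (A : lmodType K) (mul : {bilinear A -> A -> A}) (w : {scalar A}),
         bernstein mul w -> finitely_generated mul ->
         (exists2 r, train_algebra mul w r & (r <= 3)%N) ->
         (exists2 d, algebraic_of_bounded_degree mul d & (d <= 2)%N) /\
         finite_dim A),
      (exists (A : lmodType K) (mul : {bilinear A -> A -> A}) (w : {scalar A}),
         [/\ bernstein mul w, finitely_generated mul,
             train_algebra mul w 4 & ~ finite_dim A])
    & (forall d n : nat, (3 <= d)%N -> (2 <= n)%N ->
       exists (A : lmodType K) (mul : {bilinear A -> A -> A}) (w : {scalar A}),
         [/\ bernstein mul w, generated_by mul n,
             algebraic_of_bounded_degree mul d & ~ finite_dim A])].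
Proof.
have K2 : 2%:R != 0 :> K by move: K_char2; rewrite inE.
have K3 : 3%:R != 0 :> K by move: K_char3; rewrite inE.
have small A mul w : @bernstein K A mul w -> finitely_generated mul ->
    (exists2 r, train_algebra mul w r & (r <= 3)%N) ->
  degrees_le mul 2 /\ finite_dim A.
  move=> bern fg [r [_ [le2r train_r _]] ler3].
  have deg2 : degrees_le mul 2 by apply: (train_degree bern _ train_r); rewrite le2r.
  by split; last exact: (finite_dim_of_degree2 K2 K3 bern).
split.
- move=> A mul w bern fg [d [_ deg_d _] le_d2].
  apply: (finite_dim_of_degree2 K2 K3 bern) fg => x.
  by have [k alg_k le_kd] := deg_d x; exists k; last exact: leq_trans le_d2.
- move=> A mul w bern fg train3; have [deg2 fdA] := small A mul w bern fg train3.
  by split=> //; apply: min_degree.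
- have [A [mul [w [bern gen2 _ infA /(_ erefl) train4]]]] := ladder_exists (m := 0) K2 (leqnn 2).
  have fg : finitely_generated mul by exists 2%N.
  exists A, mul, w; split=> //; split; first by case: bern.
  (* Rank 4 is minimal: a train equation of rank at most 3 would force finite dimension. *)
  split=> // s le2s train_s; rewrite leqNgt; apply/negP => lt_s4.
  apply: infA; apply: (finite_dim_of_degree2 K2 K3 bern) fg.
  by apply: (train_degree bern _ train_s); rewrite le2s.
(* A tail of length d - 3 gives bounded degree d. *)
- move=> d n le3d le2n; have -> : d = (d - 3).+3 by rewrite -addn3 subnK.
  have [A [mul [w [bern gen deg infA _]]]] := ladder_exists (m := d - 3) K2 le2n.
  by exists A, mul, w.
Qed.
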